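(* Let $n,k\in\mathbb N$, let $\theta$ be a threshold function, and consider either the MaxExp or the MaxProb objective. Suppose that the algorithm which, given any predicted prior $G$, runs the bi-criteria algorithm $\mathcal A(G,\theta)$, is $\alpha$-consistent and $\beta$-robust on instances with $nk$ values. Then there is an algorithm (namely the one that, given predicted prior $\tilde F$, samples $nk$ i.i.d. uniform times on $[0,1]$, sorts them as $t'_{11}<\dots<t'_{1k}<t'_{21}<\dots<t'_{nk}$, picks $s_i$ uniformly from $\{t'_{i1},\dots,t'_{ik}\}$ for each $i$, and accepts the $i$-th arriving value $x_i$, if nothing has been accepted yet, iff $x_i$ is best-so-far and $\tilde F(x_i)^{1/k}>\theta(s_i)$) that is $\alpha$-consistent and $\beta$-robust on instances with $n$ values.
   Context: Optimal stopping with a predicted prior (continuous-time model): $n$ values drawn i.i.d. from an unknown prior $F$, each with independent uniform arrival time in $[0,1]$, revealed in arrival order; an online algorithm (knowing $n$, a predicted prior $\tilde F$, the history, and internal randomness) irrevocably accepts at most one. Standing assumption: all priors (true and predicted) are continuous distributions with full support on $[0,\infty)$, identified with their cdfs. $x_{\mathrm{ALG}}$ is the accepted value ($0$ if none), $x_{\mathrm{OPT}}$ the maximum value. MaxExp ratio: $\mathbb E[x_{\mathrm{ALG}}]/\mathbb E[x_{\mathrm{OPT}}]$; MaxProb ratio: $\Pr[x_{\mathrm{ALG}}=x_{\mathrm{OPT}}]$. $\alpha$-consistent: $\alpha$-competitive for every $F$ when $\tilde F=F$; $\beta$-robust: $\beta$-competitive for every $F$ and every $\tilde F$. A threshold function is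 a non-increasing $\theta:[0,1]\to[0,1]$. The prefix maximum for time $t$ is the maximum of values arriving before $t$ ($0$ if none); a value is best-so-far if it is at least the prefix maximum for its arrival time. The bi-criteria algorithm $\mathcal A(G,\theta)$ accepts a value $x_i$ arriving at time $t_i$ (while nothing has been accepted) iff it is best-so-far and $G(x_i)>\theta(t_i)$. *)

(* Defs.v *)
From HB Require Import structures.
From mathcomp Require Import all_boot all_order all_algebra.
From mathcomp Require Import all_classical all_reals all_analysis.
Set Implicit Arguments. Unset Strict Implicit. Unset Printing Implicit Defensive.
Import Order.TTheory GRing.Theory Num.Theory numFieldNormedType.Exports.
Local Open Scope classical_set_scope.
Local Open Scope ring_scope.

Section OptimalStopping.
Variable R : realType.

Definition prob := probability (measurableTypeR R) R.

Definition cdf (P : prob) (x : R) : R := fine (P [set` `]-oo, x]]).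

(* Standing assumption: continuous distribution with full support on [0,oo). *)
Definition is_prior (P : prob) : Prop :=
  continuous (cdf P) /\
  (forall x, x < 0 -> cdf P x = 0) /\
  (forall x y, 0 <= x -> x < y -> cdf P x < cdf P y).

Definition is_threshold (theta : R -> R) : Prop :=
  (forall t, 0 <= t <= 1 -> 0 <= theta t <= 1) /\
  (forall s t, 0 <= s -> s <= t -> t <= 1 -> theta t <= theta s).

Definition inst := seq (R * R).

Definition val (s : inst) (j : nat) : R := (nth (0, 0) s j).1.
Definition time (s : inst) (j : nat) : R := (nth (0, 0) s j).2.

(* l arrives strictly before j (ties, a null event, broken by index). *)
Definition before (s : inst) (l j : nat) : bool :=
  (time s l < time s j) || ((time s l == time s j) && (l < j)%N).

Definition arrival (s : inst) : seq nat :=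
  sort (fun l j => (l == j) || before s l j) (iota 0 (size s)).

Definition prefix_max (s : inst) (j : nat) : R :=
  \big[Num.max/0]_(l <- iota 0 (size s) | before s l j) val s l.

Definition best_so_far (s : inst) (j : nat) : bool := prefix_max s j <= val s j.

Definition x_opt (s : inst) : R := \big[Num.max/0]_(p <- s) p.1.

(* The value accepted by the online rule that irrevocably accepts the first
   arriving index j (nothing accepted before) with [acc j]; 0 if none. *)
Definition x_alg (s : inst) (acc : nat -> bool) : R :=
  match [seq j <- arrival s | acc j] with
  | j :: _ => val s j
  | [::] => 0
  end.

Definition accA (G theta : R -> R) (s : inst) (j : nat) : bool :=
  best_so_far s j && (theta (time s j) < G (val s j)).

(* The reduction algorithm for parameter k, predicted cdf Ft, internal
   randomness u (n*k i.i.d. uniform times) and c (uniform choices). The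
   i-th arriving value (i = rank in arrival order) uses
   s_i = t'_{i, c_i}, where t' is u sorted increasingly. *)
Definition s_thr (n k : nat) (u : seq R) (c : {ffun 'I_n -> 'I_k}) (i : nat) : R :=
  nth 0 (sort <=%R u) (i * k + nth 0%N [seq nat_of_ord (c r) | r <- enum 'I_n] i).

Definition accB (n k : nat) (Ft theta : R -> R) (u : seq R) (c : {ffun 'I_n -> 'I_k})
    (s : inst) (j : nat) : bool :=
  best_so_far s j &&
  (theta (s_thr u c (index j (arrival s))) < powR (Ft (val s j)) (k%:R^-1)).

Fixpoint E_inst (P : prob) (m : nat) (f : inst -> \bar R) : \bar R :=
  match m with
  | 0 => f [::]
  | m'.+1 => (\int[P]_x (\int[lebesgue_measure]_(t in `[0%R, 1%R]) 
               E_inst P m' (fun s => f ((x, t) :: s))))%E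
  end.

Fixpoint E_unif (m : nat) (f : seq R -> \bar R) : \bar R :=
  match m with
  | 0 => f [::]
  | m'.+1 => (\int[lebesgue_measure]_(v in `[0%R, 1%R]) E_unif m' (fun w => f (v :: w)))%E
  end.

Inductive objective := MaxExp | MaxProb.

Definition reward (o : objective) (s : inst) (xa : R) : \bar R :=
  match o with
  | MaxExp => xa%:E
  | MaxProb => (xa == x_opt s)%:R%:E
  end.

Definition bench (o : objective) (P : prob) (m : nat) : \bar R :=
  match o with
  | MaxExp => E_inst P m (fun s => (x_opt s)%:E)
  | MaxProb => 1%E
  end.

Definition competitive (o : objective) (P : prob) (m : nat) (gamma : R)
  (expected_reward : \bar R) : Prop :=
  (gamma%:E * bench o P m <= expected_reward)%E.

Definition reward_A (o : objective) (P : prob) (m : nat) (G theta : R -> R) : \bar R :=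
  E_inst P m (fun s => reward o s (x_alg s (accA G theta s))).

Definition reward_B (o : objective) (P : prob) (n k : nat) (Ft theta : R -> R) : \bar R :=
  (\sum_(c : {ffun 'I_n -> 'I_k}) (#|{ffun 'I_n -> 'I_k}|%:R^-1)%:E *
     E_unif (n * k) (fun u =>
       E_inst P n (fun s => reward o s (x_alg s (accB Ft theta u c s)))))%E.

Definition consistent_A o m theta alpha : Prop :=
  forall F : prob, is_prior F -> competitive o F m alpha (reward_A o F m (cdf F) theta).
Definition robust_A o m theta beta : Prop :=
  forall F Ft : prob, is_prior F -> is_prior Ft ->
    competitive o F m beta (reward_A o F m (cdf Ft) theta).

Definition consistent_B o n k theta alpha : Prop :=
  forall F : prob, is_prior F -> competitive o F n alpha (reward_B o F n k (cdf F) theta).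
Definition robust_B o n k theta beta : Prop :=
  forall F Ft : prob, is_prior F -> is_prior Ft ->
    competitive o F n beta (reward_B o F n k (cdf Ft) theta).

End OptimalStopping.

(* Main.v *)
Require Import Defs.
From HB Require Import structures.
From mathcomp Require Import all_boot all_order all_algebra.
From mathcomp Require Import all_classical all_reals all_analysis.
From mathcomp Require Import measurable_realfun zify.
Import Defs.
Set Implicit Arguments. Unset Strict Implicit. Unset Printing Implicit Defensive.
Import Order.TTheory GRing.Theory Num.Theory numFieldNormedType.Exports.
Local Open Scope classical_set_scope.
Local Open Scope ring_scope.

(* Couple the two instances. If P has cdf F^(1/k), the maximum of a block of k
   independent draws from P has law F, and its position in the block is uniform
   and independent of it. Cut an instance of n * k values from P, in arrival
   order, into n consecutive blocks: the block maxima together with their arrival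
   times are distributed as the values and the times s_i seen by the reduction
   algorithm B. On each such instance B does at least as well as A: if A accepts a
   value y inside a block, then y is at most the block maximum M, which arrives no
   earlier (after M nothing in the block is best so far), so M is best so far and
   passes the lower threshold; and if A accepts nothing in a block, then M fails
   the test of B as well. Both instances have the same overall maximum. *)

(** The root is taken of the true and of the predicted prior alike. The test of B is then literally
    the test of A for the prediction [Pt] with cdf [Ft^(1/k)], so both rules compare the same
    function of the value with [theta]. A correct prediction stays correct ([Ft = F] gives
    [Pt = P]), hence one comparison of rewards yields both consistency and robustness.

    Blocks of consecutive arrivals can be treated as blocks of independent draws because the arrival
    order depends on the times alone and i.i.d. values are exchangeable: read in arrival order, the
    values are again i.i.d. and independent of the sorted times. The n * k random times of B then
    take the part of the arrival times of A.

    No joint probability space is built. The coupling is an identity between nested integrals: when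
    draws from [P] are integrated block by block, draws from [F] and uniform choices come out. The
    price is that every exchange of integrals asks for joint measurability of functions of lists,
    including the arrival order and the position of a maximum. *)

(** * Measurability for functions of lists *)

Section MeasurableLists.
Context {R : realType}.

(* Measurability of a function of lists of length m is tested along all
   measurable families of lists, so that no sigma-algebra on [seq T] is needed. *)
Definition mlist dX (X : measurableType dX) d (T : measurableType d)
    (m : nat) (L : X -> seq T) : Prop :=
  (forall x, size (L x) = m) /\
  (forall t0 i, measurable_fun setT (fun x => nth t0 (L x) i)).

Definition mfun d (T : measurableType d) (m : nat) (f : seq T -> \bar R) :=
  forall dX (X : measurableType dX) (L : X -> seq T), mlist m L ->
    measurable_fun setT (fun x => f (L x)).

(** The parameter in [Y] is there for inductions on the length: the head of the list is moved into
    it, and [Y] becomes [Y * T]. *)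
Definition jmeas dY (Y : measurableType dY) d (T : measurableType d)
    (m : nat) (h : Y -> seq T -> \bar R) :=
  forall dX (X : measurableType dX) (y : X -> Y) (L : X -> seq T),
    measurable_fun setT y -> mlist m L ->
    measurable_fun setT (fun x => h (y x) (L x)).

(** Measurability for discrete data such as positions and permutations, fibre by fibre, which asks
    for no sigma-algebra on [K]. *)
Definition dmeas dX (X : measurableType dX) (K : eqType) (h : X -> K) :=
  forall a, measurable_fun setT (fun x => h x == a).

Section closure.
Context dX (X : measurableType dX) d (T : measurableType d).

Lemma mlist_nil : mlist 0 (fun _ : X => [::] : seq T).
Proof. by split=> // t0 i; rewrite nth_nil. Qed.

Lemma mlist_cons m (h : X -> T) (L : X -> seq T) : measurable_fun setT h ->
  mlist m L -> mlist m.+1 (fun x => h x :: L x).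
Proof. by move=> mh [sL mL]; split=> [x|t0 [|i]] //=; rewrite sL. Qed.

Lemma mlist_cst (s : seq T) : mlist (size s) (fun _ : X => s).
Proof. by split=> // t0 i; exact: measurable_cst. Qed.

Lemma mlist_cat m n (L M : X -> seq T) : mlist m L -> mlist n M ->
  mlist (m + n) (fun x => L x ++ M x).
Proof.
move=> [sL mL] [sM mM]; split=> [x|t0 i]; first by rewrite size_cat sL sM.
rewrite (_ : (fun _ => _) = fun x => if (i < m)%N then nth t0 (L x) i
  else nth t0 (M x) (i - m)); last by apply/funext => x; rewrite nth_cat sL.
by case: (i < m)%N.
Qed.

Lemma mlist_take m n (L : X -> seq T) : mlist m L -> (n <= m)%N ->
  mlist n (fun x => take n (L x)).
Proof.
move=> [sL mL] nm; split=> [x|t0 i]; first by rewrite size_takel// sL.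
have [ni|ni] := leqP n i.
  rewrite (_ : (fun _ => _) = cst t0)//; apply/funext => x.
  by rewrite nth_default// size_takel// sL.
by rewrite (_ : (fun _ => _) = fun x => nth t0 (L x) i)//; apply/funext => x;
  rewrite nth_take.
Qed.

Lemma mlist_drop m n (L : X -> seq T) : mlist m L ->
  mlist (m - n) (fun x => drop n (L x)).
Proof.
move=> [sL mL]; split=> [x|t0 i]; first by rewrite size_drop sL.
by rewrite (_ : (fun _ => _) = fun x => nth t0 (L x) (n + i))//;
  apply/funext => x; rewrite nth_drop.
Qed.

Lemma mlist_mapnth m t0 (L : X -> seq T) (p : seq nat) : mlist m L ->
  mlist (size p) (fun x => [seq nth t0 (L x) i | i <- p]).
Proof.
move=> [sL mL]; split=> [x|t1 i]; first by rewrite size_map.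
have [ni|ni] := leqP (size p) i.
  rewrite (_ : (fun _ => _) = cst t1)//; apply/funext => x.
  by rewrite nth_default// size_map.
rewrite (_ : (fun _ => _) = fun x => nth t0 (L x) (nth 0%N p i))//.
by apply/funext => x; rewrite (nth_map 0%N).
Qed.

Lemma mlist_comp dX' (X' : measurableType dX') (h : X' -> X) m (L : X -> seq T) :
  measurable_fun setT h -> mlist m L -> mlist m (fun x => L (h x)).
Proof.
move=> mh [sL mL]; split=> // t0 i.
exact: (measurableT_comp (mL t0 i) mh).
Qed.

(** The countably many fibres of [h] cover [X], and on each the function agrees with a single [f a].
    This is how indices that depend on the data are handled. *)
Lemma dmeas_case (K : countType) d' (S : measurableType d') (h : X -> K)
    (f : K -> X -> S) : dmeas h -> (forall a, measurable_fun setT (f a)) ->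
  measurable_fun setT (fun x => f (h x) x).
Proof.
move=> mh mf _ B mB; rewrite setTI.
have -> : (fun x => f (h x) x) @^-1` B =
    \bigcup_(i in @setT K) ([set x | h x == i] `&` (f i @^-1` B)).
  apply/seteqP; split=> [x Bx|x [i _ [/eqP <-]]//].
  by exists (h x) => //; split=> /=.
apply: countable_bigcupT_measurable => [|a].
  exact: countableP.
apply: measurableI.
  have := mh a measurableT [set true]; rewrite setTI.
  by apply.
by rewrite -(setTI (_ @^-1` _)); exact: mf.
Qed.

End closure.

Lemma mlist_zip dX (X : measurableType dX) d1 d2 (T1 : measurableType d1)
    (T2 : measurableType d2) m (L : X -> seq T1) (M : X -> seq T2) :
  mlist m L -> mlist m M ->
  mlist m (fun x => zip (L x) (M x) : seq (T1 * T2)%type).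
Proof.
move=> [sL mL] [sM mM]; split=> [x|[a b] i]; first by rewrite size_zip sL sM minnn.
rewrite (_ : (fun _ => _) = fun x => (nth a (L x) i, nth b (M x) i)).
  exact: measurable_fun_pair.
by apply/funext => x; rewrite nth_zip// sL sM.
Qed.

End MeasurableLists.

(** * Nested integrals over lists of i.i.d. draws, and exchangeability *)

Section IteratedIntegral.
Context {R : realType}.
Local Open Scope ereal_scope.

Fixpoint iter_int d (T : measurableType d) (P : probability T R) (m : nat)
    (f : seq T -> \bar R) : \bar R :=
  match m with
  | 0 => f [::]
  | m'.+1 => \int[P]_x iter_int P m' (fun s => f (x :: s))
  end.

Section one.
Context d (T : measurableType d) (P : probability T R).
Implicit Types f g : seq T -> \bar R.

Lemma iter_int_ge0 m f : (forall s, 0 <= f s) -> 0 <= iter_int P m f.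
Proof.
elim: m f => [|m IH] f f0 //=; apply: integral_ge0 => x _; exact: IH.
Qed.

Lemma eq_iter_int m f g : (forall s, size s = m -> f s = g s) -> iter_int P m f = iter_int P m g.
Proof.
elim: m f g => [|m IH] f g fg /=; first exact: fg.
by apply: eq_integral => x _; apply: IH => s sm; apply: fg; rewrite /= sm.
Qed.

Lemma mfun_cons m f x : mfun m.+1 f -> mfun m (fun s => f (x :: s)).
Proof. by move=> mf dX X L mL; apply: mf; exact: mlist_cons. Qed.

Lemma mfun_jmeas m f : mfun m.+1 f -> jmeas m (fun x s => f (x :: s)).
Proof. by move=> mf dX X y L my mL; apply: mf; exact: mlist_cons. Qed.

Lemma jmeas_cons dY (Y : measurableType dY) m (h : Y -> seq T -> \bar R) :
  jmeas m.+1 h -> jmeas m (fun (p : Y * T) s => h p.1 (p.2 :: s)).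
Proof.
move=> mh dX X y L my mL; apply: (mh _ _ (fun x => (y x).1)).
  exact: (measurableT_comp measurable_fst my).
apply: mlist_cons => //; exact: (measurableT_comp measurable_snd my).
Qed.

(** The measurability half of Tonelli's theorem, one integral at a time; the induction must range
    over all parameter spaces because each step enlarges [Y] by a factor [T]. *)
Lemma jmeas_iter_int dY (Y : measurableType dY) m (h : Y -> seq T -> \bar R) :
  (forall y s, 0 <= h y s) -> jmeas m h ->
  measurable_fun setT (fun y => iter_int P m (h y)).
Proof.
elim: m dY Y h => [|m IH] dY Y h h0 mh /=.
  by apply: (mh _ _ id) => //; exact: mlist_nil.
have := IH _ _ _ _ (jmeas_cons mh) => /(_ (fun p s => h0 _ _)) mE.
apply: (measurable_fun_fubini_tonelli_F (m2 := P)
  (fun p : Y * T => iter_int P m (fun s => h p.1 (p.2 :: s)))) => //.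
by move=> p; apply: iter_int_ge0.
Qed.

Lemma mfun_iter_int m f : (forall s, 0 <= f s) -> mfun m.+1 f ->
  measurable_fun setT (fun x => iter_int P m (fun s => f (x :: s))).
Proof.
move=> f0 mf; apply: (@jmeas_iter_int _ T m (fun x s => f (x :: s))) => //.
exact: mfun_jmeas.
Qed.

Lemma iter_int_le m f g : (forall s, 0 <= f s) -> (forall s, 0 <= g s) ->
  mfun m f -> mfun m g ->
  (forall s, size s = m -> f s <= g s) -> iter_int P m f <= iter_int P m g.
Proof.
elim: m f g => [|m IH] f g f0 g0 mf mg fg /=; first exact: fg.
apply: ge0_le_integral => //.
- by move=> x _; exact: iter_int_ge0.
- exact: mfun_iter_int.
- exact: mfun_iter_int.
move=> x _; apply: IH => //; [exact: mfun_cons|exact: mfun_cons|].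
by move=> s sm; apply: fg; rewrite /= sm.
Qed.

Lemma iter_int_cst m (c : \bar R) : iter_int P m (fun=> c) = c.
Proof.
elim: m => //= m ->.
rewrite integral_cst// -[RHS]mule1; congr (_ * _); exact: probability_setT.
Qed.

Lemma iter_int_Zl m f (a : \bar R) : 0 <= a -> (forall s, 0 <= f s) -> mfun m f ->
  iter_int P m (fun s => a * f s) = a * iter_int P m f.
Proof.
move=> a0; elim: m f => [|m IH] f f0 mf //=.
rewrite -ge0_integralZl//; last 2 first.
- exact: mfun_iter_int.
- by move=> x _; exact: iter_int_ge0.
by apply: eq_integral => x _; apply: IH => //; exact: mfun_cons.
Qed.

Lemma iter_int_sum (I : Type) (r : seq I) m (F : I -> seq T -> \bar R) :
  (forall i s, 0 <= F i s) -> (forall i, mfun m (F i)) ->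
  iter_int P m (fun s => \sum_(i <- r) F i s) = \sum_(i <- r) iter_int P m (F i).
Proof.
elim: m F => [|m IH] F F0 mF //=.
rewrite -ge0_integral_sum//; last 2 first.
- by move=> i; exact: mfun_iter_int.
- by move=> i x _; exact: iter_int_ge0.
by apply: eq_integral => x _; apply: IH => // i; exact: mfun_cons.
Qed.

Lemma iter_int_cat m n f :
  iter_int P (m + n) f = iter_int P m (fun s => iter_int P n (fun s' => f (s ++ s'))).
Proof.
elim: m f => [|m IH] f //=.
by apply: eq_integral => x _; rewrite IH.
Qed.

Lemma iter_int_swap dY (Y : measurableType dY) (Q : probability Y R) m
    (h : Y -> seq T -> \bar R) : (forall y s, 0 <= h y s) -> jmeas m h ->
  \int[Q]_y iter_int P m (h y) = iter_int P m (fun s => \int[Q]_y h y s).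
Proof.
elim: m h => [|m IH] h h0 mh //=.
rewrite (fubini_tonelli (m1 := Q) (m2 := P)
  (fun p => iter_int P m (fun s => h p.1 (p.2 :: s))))/=; last 2 first.
- by apply: jmeas_iter_int => //; exact: jmeas_cons.
- by move=> p; exact: iter_int_ge0.
apply: eq_integral => x _; apply: (IH (fun y s => h y (x :: s))) => //.
move=> dX X y L my mL; apply: mh => //.
exact: mlist_cons.
Qed.

(** Tonelli lets any one draw be integrated outermost. This gives exchangeability, and later
    isolates the draw that is the maximum of its block. *)
Lemma iter_int_insert i m f : (i <= m)%N -> (forall s, 0 <= f s) -> mfun m.+1 f ->
  iter_int P m.+1 f = \int[P]_x iter_int P m (fun s => f (take i s ++ x :: drop i s)).
Proof.
elim: i m f => [|i IH] m f im f0 mf.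
  by apply: eq_integral => x _; apply: eq_iter_int => s _; rewrite take0 drop0.
case: m im mf => // m im mf.
transitivity (\int[P]_y \int[P]_x iter_int P m
    (fun s => f (y :: take i s ++ x :: drop i s))).
  by apply: eq_integral => y _; apply: (IH m (fun s => f (y :: s))) => //;
     exact: mfun_cons.
rewrite (fubini_tonelli (m1 := P) (m2 := P)
  (fun p => iter_int P m (fun s => f (p.1 :: take i s ++ p.2 :: drop i s))))//=.
- apply: jmeas_iter_int => // dX X y L my mL; apply: mf.
  apply: mlist_cons; first exact: (measurableT_comp measurable_fst my).
  have -> : m.+1 = (i + (m - i).+1)%N by rewrite addnS subnKC.
  apply: mlist_cat; first exact: (mlist_take mL).
  apply: mlist_cons; first exact: (measurableT_comp measurable_snd my).
  exact: mlist_drop.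
- by move=> p; exact: iter_int_ge0.
Qed.

Lemma iter_int_perm m f (t0 : T) (p : seq nat) : perm_eq p (iota 0 m) ->
  (forall s, 0 <= f s) -> mfun m f ->
  iter_int P m (fun s => f [seq nth t0 s i | i <- p]) = iter_int P m f.
Proof.
elim: m f p => [|m IH] f p pm f0 mf.
  by rewrite (perm_nilP pm).
case: p pm => [/perm_size//|i p pm].
have /= /andP[ip up] : uniq (i :: p) by rewrite (perm_uniq pm) iota_uniq.
have im : (i <= m)%N.
  by have := perm_mem pm i; rewrite inE eqxx mem_iota/= add0n ltnS => <-.
rewrite -[LHS]/(iter_int P m.+1 (fun s => f [seq nth t0 s i | i <- i :: p])).
rewrite (@iter_int_insert i)//; last first.
  move=> dX X L mL; apply: mf.
  by rewrite -(size_iota 0 m.+1) -(perm_size pm); exact: mlist_mapnth mL.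
apply: eq_integral => x _.
(* Once the draw at position [i] is set apart, the later positions move down by one; [q] is the rest
   of the permutation in the new numbering. *)
pose q := [seq unbump i j | j <- p].
have pj j : j \in p -> j != i.
  by move=> jp; apply: contraNneq ip => <-.
have qm : perm_eq q (iota 0 m).
  apply: uniq_perm; rewrite ?iota_uniq//.
    rewrite map_inj_in_uniq ?up// => a b /pj ai /pj bi.
    by move=> /(congr1 (bump i)); rewrite !unbumpK ?inE.
  have pE j : (j \in p) = (j < m.+1)%N && (j != i).
    have := perm_mem pm j; rewrite inE mem_iota/= add0n => <-.
    by case: (eqVneq j i) => [->|_] /=; rewrite ?andbT// (negbTE ip).
  move=> a; rewrite mem_iota/= add0n; apply/mapP/idP.
    move=> [j]; rewrite pE => /andP[jm ji] ->.
    rewrite /unbump; case: (ltngtP i j) ji jm => // ij _ jm.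
      by rewrite subn1; case: j ij jm.
    by rewrite subn0; exact: leq_trans ij im.
  move=> am; exists (bump i a); last by rewrite bumpK.
  rewrite pE (eq_sym _ i) neq_bump andbT /bump; case: (i <= a)%N => //=.
  by rewrite ltnS leq_eqVlt am orbT.
rewrite -(IH (fun s => f (x :: s)) q qm)//; last exact: mfun_cons.
apply: eq_iter_int => s sm /=; congr (f (_ :: _)).
  by rewrite nth_cat size_takel ?sm// ltnn subnn.
rewrite -map_comp; apply/eq_in_map => j /pj ji /=.
rewrite nth_cat size_takel ?sm// /unbump.
case: (ltngtP i j) ji => // ij _.
  by rewrite -(subnSK ij) /= nth_drop; congr nth; lia.
by rewrite nth_take// subn0.
Qed.

End one.

End IteratedIntegral.

(** * Pointwise comparison of the two rules *)

Section ListRun.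
Context {R : realType}.

(** The common form of both algorithms, on values in arrival order: only the times [ts] at which
    [theta] is read differ. The accumulator [m] is the prefix maximum. *)
Fixpoint run (theta G : R -> R) (m : R) (xs ts : seq R) : R :=
  match xs, ts with
  | x :: xs', t :: ts' =>
      if (m <= x) && (theta t < G x) then x
      else run theta G (Num.max m x) xs' ts'
  | _, _ => 0
  end.

Definition max0 (xs : seq R) : R := \big[Num.max/0]_(x <- xs) x.

Definition run_reward (theta G : R -> R) (o : objective) (xs ts : seq R) : \bar R :=
  match o with
  | MaxExp => (run theta G 0 xs ts)%:E
  | MaxProb => (run theta G 0 xs ts == max0 xs)%:R%:E
  end.

(* Ties go to the last index: the algorithms accept a value equal to the prefix
   maximum, so with the first argmax a later tied value, facing a lower
   threshold, could be accepted by A but not by B. *)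
Fixpoint lastmax (b : seq R) : nat :=
  if b is x :: b' then
    if all (fun y => y < x) b' then 0%N else (lastmax b').+1
  else 0%N.

Definition bmax (b : seq R) : R := nth 0 b (lastmax b).

Lemma max0_cons x xs : max0 (x :: xs) = Num.max x (max0 xs).
Proof. by rewrite /max0 big_cons. Qed.

Lemma max0_ge0 xs : 0 <= max0 xs.
Proof.
elim: xs => [|x xs IH]; first by rewrite /max0 big_nil.
by rewrite max0_cons le_max IH orbT.
Qed.

Lemma run_ge0 theta G m xs ts : 0 <= m -> 0 <= run theta G m xs ts.
Proof.
elim: xs ts m => [|x xs IH] [|t ts] m m0 //=.
case: ifP => [/andP[mx _]|_]; first exact: le_trans mx.
by apply: IH; rewrite le_max m0.
Qed.

Lemma run_le_max0 theta G m xs ts : run theta G m xs ts <= max0 xs.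
Proof.
elim: xs ts m => [|x xs IH] [|t ts] m; rewrite ?max0_ge0//=.
by rewrite max0_cons le_max; case: ifP; rewrite ?lexx// IH orbT.
Qed.

Lemma run_reward_ge0 theta G o xs ts : (0 <= run_reward theta G o xs ts)%E.
Proof. by case: o; rewrite /run_reward lee_fin ?run_ge0. Qed.

Lemma lastmax_lt b : b != [::] -> (lastmax b < size b)%N.
Proof.
elim: b => //= x b IH _; case: ifP => // bx.
by rewrite ltnS IH//; case: b bx {IH}.
Qed.

Lemma le_bmax b x : x \in b -> x <= bmax b.
Proof.
elim: b x => //= y b IH x; rewrite inE /bmax /=.
case: ifP => [/allP b_y|/negbT/allPn[z zb]].
  by case/predU1P => [->//|/b_y/ltW].
rewrite -leNgt => yz; case/predU1P => [->|/IH//].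
exact: (le_trans yz (IH _ zb)).
Qed.

(** Comparisons between entries are the form from which both the measurability and the law of the
    position are derived. *)
Lemma lastmaxP b c : b != [::] ->
  (lastmax b == c) = [&& (c < size b)%N, all (fun y => y <= nth 0 b c) (take c b)
                       & all (fun y => y < nth 0 b c) (drop c.+1 b)].
Proof.
elim: b c => //= x b IH c _; case: ifP => [/allP bx|/negbT/allPn[y yb xy]].
  case: c => [|c] /=; first by rewrite drop0 eqxx; symmetry; apply/allP.
  rewrite ltnS; apply/esym/negbTE; apply/and3P => -[cb /andP[+ _] _].
  by rewrite leNgt bx// mem_nth.
case: c => [|c] /=.
  rewrite drop0; apply/esym/negbTE.
  by apply/allPn; exists y.
rewrite eqSS ltnS IH; last by case: (b) yb.
rewrite -leNgt in xy.
case: (ltnP c (size b)) => //= cb.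
case: (boolP (all _ (take c b))) => [/allP cy|_]; last by rewrite andbF.
case: (boolP (all _ (drop c.+1 b))) => [/allP dy|_]; last by rewrite !andbF.
rewrite !andbT; apply/esym.
apply: (le_trans xy); move: yb; rewrite -{1}(cat_take_drop c b) mem_cat.
rewrite (drop_nth 0)// inE => /orP[/cy//|/predU1P[->//|/dy/ltW//]].
Qed.

Section pointwise.
Variables theta G : R -> R.
Hypothesis theta_ni : forall s t, s <= t -> theta t <= theta s.
Hypothesis G_nd : forall x y, x <= y -> G x <= G y.

Lemma run_skip m b xs tb ts : size b = size tb -> all (fun y => y < m) b ->
  run theta G m (b ++ xs) (tb ++ ts) = run theta G m xs ts.
Proof.
elim: b tb => [|x b IH] [|t tb]//= [sb] /andP[xm bm].
by rewrite leNgt xm /= max_l ?ltW// IH.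
Qed.

(** The branches are the two outcomes of one step of the reduction algorithm. The second is an
    equality: A passes over the whole block too, so both go on from the same running maximum. *)
Lemma run_block m b xs (tb ts : seq R) : b != [::] -> size b = size tb ->
  sorted <=%R tb ->
  if (m <= bmax b) && (theta (nth 0 tb (lastmax b)) < G (bmax b))
  then is_true (run theta G m (b ++ xs) (tb ++ ts) <= bmax b)
  else run theta G m (b ++ xs) (tb ++ ts) =
       run theta G (Num.max m (bmax b)) xs ts.
Proof.
elim: b tb m => [//|x b IH] [//|t tb] m _ [sb] tb_s.
rewrite /bmax /=; case: (boolP (all _ b)) => bx.
  (* The head is the last maximum: what follows in the block lies strictly below it and is never
     best so far. *)
  rewrite /=; case: ((m <= x) && _); rewrite /= ?lexx//; apply: run_skip => //.
  apply/allP => y yb; rewrite lt_max; apply/orP; right; exact: (allP bx).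
have b0 : b != [::] by case: b bx {IH sb}.
have xM : x <= bmax b.
  case/allPn: bx => y yb; rewrite -leNgt => /le_trans; apply; exact: le_bmax.
have tM : t <= nth 0 tb (lastmax b).
  move: tb_s; rewrite /= (path_sortedE le_trans) => /andP[/allP tb_t _].
  by apply: tb_t; rewrite mem_nth// -sb lastmax_lt.
rewrite /= -/(bmax b); case: ifP => [/andP[mM tG]|/negbT accM].
  case: ifP => // accx.
  have := IH tb (Num.max m x) b0 sb (path_sorted tb_s).
  by rewrite ge_max mM xM tG.
(* If [x] were accepted, the block maximum, at least as large and not earlier, would pass its test
   as well, against [accM]. *)
case: ifP => [/andP[mx tx]|accx].
  case/negP: accM; rewrite (le_trans mx xM)/=.
  exact: (le_lt_trans (theta_ni tM) (lt_le_trans tx (G_nd xM))).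
have := IH tb (Num.max m x) b0 sb (path_sorted tb_s).
by rewrite ge_max xM andbT (negbTE accM) -maxA (max_r xM).
Qed.

(** The indexing of [s_thr], with the choices as a plain list, so that the positions of the block
    maxima can be put in their place. *)
Definition pick_times (k n : nat) (ts : seq R) (cs : seq nat) : seq R :=
  mkseq (fun i => nth 0 ts (i * k + nth 0%N cs i)) n.

Lemma run_blocks k n m xs ts : (0 < k)%N -> size xs = (n * k)%N ->
  size ts = (n * k)%N -> sorted <=%R ts ->
  let bs := reshape (nseq n k) xs in
  run theta G m xs ts <=
  run theta G m (map bmax bs) (pick_times k n ts (map lastmax bs)).
Proof.
move=> k0; elim: n m xs ts => [|n IH] m xs ts /=.
  by move=> /size0nil -> _ _.
move=> sx st ts_s.
set b := take k xs; set xs' := drop k xs.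
pose tb := take k ts; pose ts' := drop k ts.
have sb : size b = k by rewrite size_takel// sx mulSn leq_addr.
have stb : size tb = k by rewrite size_takel// st mulSn leq_addr.
have sx' : size xs' = (n * k)%N by rewrite size_drop sx mulSn addKn.
have st' : size ts' = (n * k)%N by rewrite size_drop st mulSn addKn.
have b0 : b != [::] by rewrite -size_eq0 sb -lt0n.
have lb : (lastmax b < k)%N by rewrite -[ltnRHS]sb lastmax_lt.
have E : pick_times k n.+1 ts (lastmax b :: [seq lastmax i | i <- reshape (nseq n k) xs'])
   = nth 0 tb (lastmax b) :: pick_times k n ts' [seq lastmax i | i <- reshape (nseq n k) xs'].
  rewrite /pick_times /mkseq /= mul0n add0n nth_take//; congr (_ :: _).
  rewrite -[1%N]addn0 iotaDl -map_comp; apply: eq_map => i /=.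
  by rewrite nth_drop add1n mulSn addnA.
rewrite -[leRHS]/(run theta G m (bmax b :: map bmax (reshape (nseq n k) xs'))
  (pick_times k n.+1 ts (lastmax b :: [seq lastmax i | i <- reshape (nseq n k) xs']))).
rewrite E.
have := run_block m xs' ts' b0 (etrans sb (esym stb)) (take_sorted k ts_s).
rewrite !cat_take_drop /=; case: ifP => // _ ->.
by apply: IH => //; exact: drop_sorted.
Qed.

End pointwise.

Lemma bmax_cons x b : b != [::] -> bmax (x :: b) = Num.max x (bmax b).
Proof.
move=> b0; rewrite {1}/bmax /=; case: ifP => [/allP bx|/negbT/allPn[z zb]].
  by rewrite max_l//; apply/ltW/bx; rewrite mem_nth// lastmax_lt.
by rewrite -leNgt => xz; rewrite max_r//; exact: le_trans xz (le_bmax zb).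
Qed.

Lemma max0_block b xs : b != [::] -> max0 (b ++ xs) = Num.max (bmax b) (max0 xs).
Proof.
elim: b => // x b IH _; rewrite cat_cons max0_cons.
case: b IH => [|y b] IH; first by rewrite /bmax.
by rewrite IH// (@bmax_cons x)// maxA.
Qed.

Lemma max0_blocks k n xs : (0 < k)%N -> size xs = (n * k)%N ->
  max0 (map bmax (reshape (nseq n k) xs)) = max0 xs.
Proof.
move=> k0; elim: n xs => [|n IH] xs /=; first by move=> /size0nil ->.
move=> sx; rewrite max0_cons IH ?size_drop ?sx ?mulSn ?addKn//.
rewrite -max0_block ?cat_take_drop// -size_eq0 size_takel -?lt0n//.
by rewrite sx mulSn leq_addr.
Qed.

(** For [MaxProb]: if A gets the overall maximum, then B gets at least that, and it can never get
    more than the same maximum. *)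
Lemma run_reward_blocks (theta G : R -> R) o k n xs ts :
  (forall s t, s <= t -> theta t <= theta s) ->
  (forall x y, x <= y -> G x <= G y) ->
  (0 < k)%N -> size xs = (n * k)%N ->
  size ts = (n * k)%N -> sorted <=%R ts ->
  let bs := reshape (nseq n k) xs in
  (run_reward theta G o xs ts <=
   run_reward theta G o (map bmax bs) (pick_times k n ts (map lastmax bs)))%E.
Proof.
move=> th Gn k0 sx st ts_s /=.
have /= rr := run_blocks th Gn 0 k0 sx st ts_s.
case: o; rewrite /run_reward lee_fin//.
case: eqP => [e|_]; last by rewrite ler0n.
rewrite max0_blocks//.
suff -> : run theta G 0 (map bmax (reshape (nseq n k) xs))
   (pick_times k n ts (map lastmax (reshape (nseq n k) xs))) == max0 xs by [].
by rewrite eq_le -{2}e rr andbT -(@max0_blocks k n xs)// run_le_max0.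
Qed.

End ListRun.

(** * From instances to lists in arrival order *)

Section Arrival.
Context {R : realType}.
Implicit Types (s : inst R) (ts xs : seq R).

(** [before] as a function of the times alone, which makes visible that the arrival order ignores
    the values. *)
Definition earlier ts (l j : nat) : bool :=
  (nth 0 ts l < nth 0 ts j) || ((nth 0 ts l == nth 0 ts j) && (l < j)%N).

Definition earlier_eq ts : rel nat := fun l j => (l == j) || earlier ts l j.

Definition arrival_perm ts : seq nat := sort (earlier_eq ts) (iota 0 (size ts)).

Lemma valE s : val s = nth 0 (unzip1 s).
Proof.
apply/funext => j; rewrite /val; have [sj|sj] := ltnP j (size s).
  by rewrite (nth_map (0, 0)).
by rewrite !nth_default// size_map.
Qed.

Lemma timeE s : time s = nth 0 (unzip2 s).
Proof.
apply/funext => j; rewrite /time; have [sj|sj] := ltnP j (size s).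
  by rewrite (nth_map (0, 0)).
by rewrite !nth_default// size_map.
Qed.

Lemma arrivalE s : arrival s = arrival_perm (unzip2 s).
Proof. by rewrite /arrival /arrival_perm size_map /before timeE. Qed.

Lemma earlier_irr ts j : earlier ts j j = false.
Proof. by rewrite /earlier ltxx ltnn andbF. Qed.

Lemma earlier_trans ts : transitive (earlier ts).
Proof.
move=> b a c; rewrite /earlier => /orP[ab|/andP[/eqP-> ab]].
  by move=> /orP[/(lt_trans ab)->//|/andP[/eqP<- _]]; rewrite ab.
move=> /orP[->//|/andP[/eqP-> bc]]; by rewrite eqxx (ltn_trans ab bc) orbT.
Qed.

Lemma earlier_eq_trans ts : transitive (earlier_eq ts).
Proof.
move=> b a c; rewrite /earlier_eq => /predU1P[->//|ab] /predU1P[<-|bc].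
  by rewrite ab orbT.
by rewrite (earlier_trans ab bc) orbT.
Qed.

Lemma earlier_eq_total ts : total (earlier_eq ts).
Proof.
move=> a b; rewrite /earlier_eq /earlier.
case: (ltgtP (nth 0 ts a) (nth 0 ts b)) => _ /=; rewrite ?orbT//.
by case: (ltngtP a b).
Qed.

Lemma earlier_eq_anti ts : antisymmetric (earlier_eq ts).
Proof.
move=> a b; rewrite /earlier_eq => /andP[/predU1P[->//|ab] /predU1P[//|ba]].
by have := earlier_trans ab ba; rewrite earlier_irr.
Qed.

Lemma arrival_perm_perm ts : perm_eq (arrival_perm ts) (iota 0 (size ts)).
Proof. by rewrite /arrival_perm perm_sort. Qed.

Lemma arrival_perm_sorted ts : sorted (earlier_eq ts) (arrival_perm ts).
Proof. exact/sort_sorted/earlier_eq_total. Qed.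

Lemma arrival_perm_uniq ts : uniq (arrival_perm ts).
Proof. by rewrite (perm_uniq (arrival_perm_perm ts)) iota_uniq. Qed.

(** Ties are broken by index, so the order is antisymmetric and the sorted arrangement unique. Being
    a given permutation thus becomes a finite conjunction of comparisons of times, which is
    measurable. *)
Lemma arrival_perm_eq ts p :
  (arrival_perm ts == p) = perm_eq p (iota 0 (size ts)) && sorted (earlier_eq ts) p.
Proof.
apply/eqP/andP => [<-|[pp ps]]; first by rewrite arrival_perm_perm arrival_perm_sorted.
apply: (sorted_eq (@earlier_eq_trans ts) (@earlier_eq_anti ts)) => //.
  exact: arrival_perm_sorted.
by rewrite (perm_trans (arrival_perm_perm _))// perm_sym.
Qed.

Lemma sort_arrival_perm ts : sort <=%R ts = [seq nth 0 ts j | j <- arrival_perm ts].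
Proof.
apply: (sorted_eq le_trans le_anti).
- exact/sort_sorted/le_total.
- apply: homo_sorted (arrival_perm_sorted ts) => a b.
  by move=> /predU1P[->//|/orP[/ltW//|/andP[/eqP->]]].
- rewrite perm_sort perm_sym.
  rewrite -[X in perm_eq _ X](mkseq_nth 0) /mkseq.
  exact: perm_map (arrival_perm_perm ts).
Qed.

(** Turns the prefix maximum, defined by comparing times, into a maximum over an initial segment of
    the arrival order. *)
Lemma filter_earlier ts p1 j p2 : arrival_perm ts = p1 ++ j :: p2 ->
  [seq l <- arrival_perm ts | earlier ts l j] = p1.
Proof.
move=> e; have := arrival_perm_uniq ts; have := arrival_perm_sorted ts.
rewrite (sorted_pairwise (@earlier_eq_trans ts)) e pairwise_cat /=.
rewrite allrel_consr => /and3P[/andP[/allP p1j _] _ /andP[/allP jp2 _]].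
rewrite cat_uniq /= => /and3P[_ /norP[jp1 _] /andP[njp2 _]].
rewrite filter_cat /= earlier_irr.
have -> : [seq l <- p2 | earlier ts l j] = [::].
  apply/eqP; rewrite -(negbK (_ == _)) -has_filter; apply/hasPn => l lp2.
  apply/negP => lj; case/predU1P: (jp2 _ lp2) => [jl|jl].
    by move: njp2; rewrite jl lp2.
  by have := earlier_trans lj jl; rewrite earlier_irr.
rewrite cats0; apply/all_filterP/allP => l lp1.
by case/predU1P: (p1j _ lp1) => // lj; move: jp1; rewrite -lj lp1.
Qed.

Lemma max0_rcons xs (x : R) : max0 (rcons xs x) = Num.max (max0 xs) x.
Proof.
elim: xs => [|y xs IH] /=; first by rewrite max0_cons maxC.
by rewrite !max0_cons IH maxA.
Qed.

Lemma prefix_maxE s p1 j p2 : arrival s = p1 ++ j :: p2 ->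
  prefix_max s j = max0 (map (val s) p1).
Proof.
rewrite arrivalE => e; rewrite /prefix_max -(filter_earlier e).
rewrite /max0 big_map big_filter /before timeE.
rewrite (perm_big (arrival_perm (unzip2 s)))//.
by have := arrival_perm_perm (unzip2 s); rewrite size_map perm_sym.
Qed.

(** Thresholds are indexed by arrival rank, which fits both rules: for A the i-th entry is the i-th
    arrival time, for B it is [s_i]. *)
Lemma x_alg_run (theta G : R -> R) s (acc : nat -> bool) (ths : seq R) :
  size ths = size s ->
  (forall i, (i < size s)%N -> let j := nth 0%N (arrival s) i in
    acc j = best_so_far s j && (theta (nth 0 ths i) < G (val s j))) ->
  x_alg s acc = run theta G 0 (map (val s) (arrival s)) ths.
Proof.
move=> sth accE.
have sar : size (arrival s) = size s.
  by rewrite arrivalE (perm_size (arrival_perm_perm _)) size_iota size_map.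
(* Generalized over the indices [p1] already passed: they determine the accumulator and the offset
   into [ths]. *)
suff H p2 p1 : arrival s = p1 ++ p2 ->
    match [seq j <- p2 | acc j] with j :: _ => val s j | [::] => 0 end =
    run theta G (max0 (map (val s) p1)) (map (val s) p2) (drop (size p1) ths).
  by have := H _ [::] (erefl _); rewrite /= drop0 /max0 big_nil.
elim: p2 p1 => [|j p2 IH] p1 e //=.
have sp1 : (size p1 < size s)%N.
  by rewrite -sar e size_cat /= addnS ltnS leq_addr.
rewrite (drop_nth 0) ?sth//.
have := accE _ sp1; rewrite /= {1 2 3}e nth_cat ltnn subnn /= => ->.
rewrite /best_so_far (prefix_maxE e) /=.
case: (_ && _) => //=.
rewrite -max0_rcons -map_rcons -(size_rcons p1 j); apply: IH.
by rewrite cat_rcons.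
Qed.

Lemma x_optE s : x_opt s = max0 (unzip1 s).
Proof. by rewrite /x_opt /max0 big_map. Qed.

Lemma max0_perm xs ys : perm_eq xs ys -> max0 xs = max0 ys.
Proof. exact: perm_big. Qed.

Lemma x_opt_arrival_perm s : x_opt s = max0 (map (val s) (arrival s)).
Proof.
rewrite x_optE arrivalE valE; apply: max0_perm.
rewrite -[X in perm_eq X _](mkseq_nth 0) /mkseq perm_sym; apply: perm_map.
by have := arrival_perm_perm (unzip2 s); rewrite !size_map.
Qed.

Lemma reward_run (theta G : R -> R) o s acc ths :
  size ths = size s ->
  (forall i, (i < size s)%N -> let j := nth 0%N (arrival s) i in
    acc j = best_so_far s j && (theta (nth 0 ths i) < G (val s j))) ->
  reward o s (x_alg s acc) =
  run_reward theta G o [seq nth 0 (unzip1 s) j | j <- arrival_perm (unzip2 s)] ths.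
Proof.
move=> sth accE; rewrite (x_alg_run sth accE) -arrivalE -valE.
by case: o; rewrite /reward /run_reward ?x_opt_arrival_perm.
Qed.

Lemma reward_accA (theta G : R -> R) o s :
  reward o s (x_alg s (accA G theta s)) =
  run_reward theta G o [seq nth 0 (unzip1 s) j | j <- arrival_perm (unzip2 s)]
    (sort <=%R (unzip2 s)).
Proof.
apply: reward_run; first by rewrite size_sort size_map.
move=> i si /=; rewrite /accA sort_arrival_perm (nth_map 0%N) ?timeE ?arrivalE//.
by rewrite (perm_size (arrival_perm_perm _)) size_iota size_map.
Qed.

Lemma reward_accB (theta Ft : R -> R) o n k u (c : {ffun 'I_n -> 'I_k}) s :
  size s = n ->
  reward o s (x_alg s (accB Ft theta u c s)) =
  run_reward theta (fun x => powR (Ft x) k%:R^-1) o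
    [seq nth 0 (unzip1 s) j | j <- arrival_perm (unzip2 s)]
    (pick_times k n (sort <=%R u) [seq nat_of_ord (c r) | r <- enum 'I_n]).
Proof.
move=> sn; apply: reward_run; first by rewrite size_mkseq.
move=> i si /=; rewrite /accB arrivalE index_uniq ?arrival_perm_uniq//; last first.
  by rewrite (perm_size (arrival_perm_perm _)) size_iota size_map.
by rewrite nth_mkseq// -sn.
Qed.

End Arrival.

(** * Measurability of runs, block maxima and arrival orders *)

Section MeasurableReal.
Context {R : realType} dX (X : measurableType dX).
Implicit Types L M : X -> seq R.

Definition mfun2 m n (Phi : seq R -> seq R -> \bar R) :=
  forall dX (X : measurableType dX) (L M : X -> seq R),
    mlist m L -> mlist n M -> measurable_fun setT (fun x => Phi (L x) (M x)).

Lemma mlist_head m L : mlist m L -> measurable_fun setT (fun x => nth 0 (L x) 0).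
Proof. by case=> _; exact. Qed.

Lemma mlistS m L : mlist m.+1 L -> L = fun x => nth 0 (L x) 0 :: drop 1 (L x).
Proof.
move=> [sL _]; apply/funext => x; have := sL x.
by case: (L x) => //= y s _; rewrite drop0.
Qed.

Lemma mlist_behead m L : mlist m.+1 L -> mlist m (fun x => drop 1 (L x)).
Proof. by move=> mL; have := mlist_drop 1 mL; rewrite subn1. Qed.

Lemma measurable_run (theta G : R -> R) m n (a : X -> R) L M :
  measurable_fun setT theta -> measurable_fun setT G ->
  measurable_fun setT a -> mlist m L -> mlist n M ->
  measurable_fun setT (fun x => run theta G (a x) (L x) (M x)).
Proof.
move=> mth mG; elim: m n a L M => [|m IH] n a L M ma mL mM.
  rewrite (_ : (fun _ => _) = cst 0)//; apply/funext => x.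
  by case: mL => /(_ x)/size0nil ->.
case: n mM => [|n] mM.
  rewrite (_ : (fun _ => _) = cst 0)//; apply/funext => x.
  by case: mM => /(_ x)/size0nil ->; case: (L x).
rewrite (mlistS mL) (mlistS mM) /=.
have mx := mlist_head mL; have mt := mlist_head mM.
apply: measurable_fun_ifT => //.
  apply: measurable_and; first exact: measurable_fun_ler.
  by apply: measurable_fun_ltr; exact: measurableT_comp.
apply: (IH n) => //; [|exact: mlist_behead..].
exact: measurable_maxr.
Qed.

Lemma measurable_max0 m L : mlist m L -> measurable_fun setT (fun x => max0 (L x)).
Proof.
elim: m L => [|m IH] L mL.
  rewrite (_ : (fun _ => _) = cst 0)//; apply/funext => x.
  by case: mL => /(_ x)/size0nil ->; rewrite /max0 big_nil.
rewrite (mlistS mL); under eq_fun do rewrite max0_cons.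
apply: measurable_maxr; first exact: (mlist_head mL).
by apply: IH; exact: mlist_behead.
Qed.

Lemma measurable_all (p : X -> R -> bool) m L : mlist m L ->
  (forall h : X -> R, measurable_fun setT h ->
     measurable_fun setT (fun x => p x (h x))) ->
  measurable_fun setT (fun x => all (p x) (L x)).
Proof.
move=> + mp; elim: m L => [|m IH] L mL.
  rewrite (_ : (fun _ => _) = cst true)//; apply/funext => x.
  by case: mL => /(_ x)/size0nil ->.
rewrite (mlistS mL) /=; apply: measurable_and.
  exact/mp/(mlist_head mL).
by apply: IH; exact: mlist_behead.
Qed.

Lemma dmeas_lastmax m L : (0 < m)%N -> mlist m L -> dmeas (fun x => lastmax (L x)).
Proof.
move=> m0 mL c; have sL x : size (L x) = m by case: mL => /(_ x).
rewrite (_ : (fun _ => _) = fun x => (c < m)%N &&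
    (all (fun y => y <= nth 0 (L x) c) (take c (L x)) &&
     all (fun y => y < nth 0 (L x) c) (drop c.+1 (L x)))); last first.
  by apply/funext => x; rewrite lastmaxP ?sL// -size_eq0 sL -lt0n.
have mc : measurable_fun setT (fun x => nth 0 (L x) c) by case: mL.
have [cm|_] /= := ltnP c m; last exact: measurable_cst.
apply: measurable_and.
  apply: (measurable_all (mlist_take mL (ltnW cm))) => h mh.
  exact: measurable_fun_ler.
apply: (measurable_all (mlist_drop c.+1 mL)) => h mh.
exact: measurable_fun_ltr.
Qed.

Lemma measurable_bmax m L : (0 < m)%N -> mlist m L ->
  measurable_fun setT (fun x => bmax (L x)).
Proof.
move=> m0 mL; apply: (dmeas_case (f := fun c x => nth 0 (L x) c)).
  exact: dmeas_lastmax mL.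
by move=> c; case: mL.
Qed.

Lemma mlist_bmax_blocks n k L : (0 < k)%N -> mlist (n * k) L ->
  mlist n (fun x => map bmax (reshape (nseq n k) (L x))).
Proof.
move=> k0; elim: n L => [|n IH] L mL; first exact: mlist_nil.
have mt : mlist k (fun x => take k (L x)).
  by apply: mlist_take mL _; rewrite mulSn leq_addr.
apply: mlist_cons; first exact: measurable_bmax mt.
by apply: IH; have := mlist_drop k mL; rewrite mulSn addKn.
Qed.

Lemma dmeas_lastmax_blocks n k L : (0 < k)%N -> mlist (n * k) L ->
  dmeas (fun x => map lastmax (reshape (nseq n k) (L x))).
Proof.
move=> k0; elim: n L => [|n IH] L mL p /=; first exact: measurable_cst.
case: p => [|c p]; first exact: measurable_cst.
under eq_fun do rewrite eqseq_cons.
apply: measurable_and.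
  apply: (@dmeas_lastmax k) => //.
  by apply: mlist_take mL _; rewrite mulSn leq_addr.
by apply: IH; have := mlist_drop k mL; rewrite mulSn addKn.
Qed.

Lemma measurable_sorted_earlier m L (p : seq nat) : mlist m L ->
  measurable_fun setT (fun x => sorted (earlier_eq (L x)) p).
Proof.
move=> [_ mL]; case: p => [|a p] /=; first exact: measurable_cst.
elim: p a => [|b p IH] a /=; first exact: measurable_cst.
apply: measurable_and; last exact: IH.
rewrite /earlier_eq; apply: measurable_or; first exact: measurable_cst.
rewrite /earlier; apply: measurable_or; first exact: measurable_fun_ltr.
apply: measurable_and; last exact: measurable_cst.
exact: measurable_fun_eqr.
Qed.

Lemma dmeas_arrival_perm m L : mlist m L -> dmeas (fun x => arrival_perm (L x)).
Proof.
move=> mL p; have [sL _] := mL.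
rewrite (_ : (fun _ => _) = fun x => perm_eq p (iota 0 m) &&
    sorted (earlier_eq (L x)) p); last by apply/funext => x; rewrite arrival_perm_eq sL.
apply: measurable_and; first exact: measurable_cst.
exact: measurable_sorted_earlier mL.
Qed.

Lemma mlist_arrival_perm m L M : mlist m L -> mlist m M ->
  mlist m (fun x => [seq nth 0 (L x) j | j <- arrival_perm (M x)]).
Proof.
move=> mL mM; split=> [x|t0 i].
  by case: mM => /(_ x) sM _; rewrite size_map (perm_size (arrival_perm_perm _)) size_iota.
apply: (dmeas_case (f := fun p x => nth t0 [seq nth 0 (L x) j | j <- p] i)).
  exact: dmeas_arrival_perm mM.
by move=> p; have [_] := mlist_mapnth (0 : R) p mL; exact.
Qed.

Lemma mlist_sort m L : mlist m L -> mlist m (fun x => sort <=%R (L x)).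
Proof. by move=> mL; under eq_fun do rewrite sort_arrival_perm; exact: mlist_arrival_perm. Qed.

Lemma mlist_pick_times k n m L cs : mlist m L -> mlist n (fun x => pick_times k n (L x) cs).
Proof.
move=> mL; pose p := [seq (i * k + nth 0%N cs i)%N | i <- iota 0 n].
have := mlist_mapnth (0 : R) p mL; rewrite size_map size_iota.
by under eq_fun do rewrite -map_comp.
Qed.

End MeasurableReal.

Lemma mfun2_run_reward {R : realType} (theta G : R -> R) o m n :
  measurable_fun setT theta -> measurable_fun setT G ->
  mfun2 m n (run_reward theta G o).
Proof.
move=> mth mG dX X L M mL mM.
have mr : measurable_fun setT (fun x => run theta G 0 (L x) (M x)).
  by apply: (measurable_run (a := cst 0) mth mG _ mL mM); exact: measurable_cst.
case: o; rewrite /run_reward; first exact/measurable_EFinP.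
apply/measurable_EFinP.
rewrite (_ : (fun _ => _) = fun x =>
  if run theta G 0 (L x) (M x) == max0 (L x) then 1 else 0); last first.
  by apply/funext => x; case: (_ == _).
apply: measurable_fun_ifT => //.
by apply: measurable_fun_eqr => //; exact: measurable_max0 mL.
Qed.

(** * Expectations as nested integrals *)

Section Unfold.
Context {R : realType}.
Local Notation T := (measurableTypeR R).
Local Open Scope ereal_scope.

Definition unif01 : probability T R := uniform_prob (@ltr01 R).

Lemma integral_unif01 (f : R -> \bar R) : measurable_fun setT f ->
  (forall x, 0 <= f x) ->
  \int[lebesgue_measure]_(t in `[0%R, 1%R]) f t = \int[unif01]_t f t.
Proof.
by move=> mf f0; rewrite integral_uniform// subr0 invr1 mul1e.
Qed.

Lemma E_unifE m (f : seq R -> \bar R) : (forall s, 0 <= f s) ->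
  mfun (T := T) m f -> E_unif m f = iter_int unif01 m f.
Proof.
elim: m f => // m IH f f0 mf /=.
rewrite -integral_unif01//.
- apply: eq_integral => t _; apply: IH => //; exact: mfun_cons mf.
- exact: (mfun_iter_int unif01 f0 mf).
- by move=> t; exact: iter_int_ge0.
Qed.

(** [E_inst] integrates values and times alternately. Tonelli brings all times outside, so that the
    arrival order is fixed while the values are integrated. *)
Lemma E_instE (P : prob R) m (f : inst R -> \bar R) : (forall s, 0 <= f s) ->
  mfun (T := (T * T)%type) m f ->
  E_inst P m f = iter_int unif01 m (fun ts => iter_int P m (fun xs => f (zip xs ts))).
Proof.
elim: m f => // m IH f f0 mf /=.
have mh x : jmeas (Y := T) m
    (fun t ts => iter_int P m (fun xs => f ((x, t) :: zip xs ts))).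
  move=> dX X y L my mL.
  apply: (@jmeas_iter_int _ _ _ P _ X _ (fun z xs => f ((x, y z) :: zip xs (L z)))).
    by move=> *; exact: f0.
  move=> dZ Z w M mw mM; apply: mf; apply: mlist_cons.
    apply: measurable_fun_pair => //; exact: (measurableT_comp my mw).
  by apply: mlist_zip => //; exact: (mlist_comp mw mL).
have mg : measurable_fun setT (fun p : T * T =>
    iter_int unif01 m (fun ts => iter_int P m (fun xs => f (p :: zip xs ts)))).
  apply: (@jmeas_iter_int _ _ _ unif01 _ (T * T)%type _
    (fun p ts => iter_int P m (fun xs => f (p :: zip xs ts)))).
    by move=> *; exact: iter_int_ge0.
  move=> dX X y L my mL.
  apply: (@jmeas_iter_int _ _ _ P _ X _ (fun z xs => f (y z :: zip xs (L z)))).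
    by move=> *; exact: f0.
  move=> dZ Z w M mw mM; apply: mf; apply: mlist_cons.
    exact: (measurableT_comp my mw).
  by apply: mlist_zip => //; exact: (mlist_comp mw mL).
transitivity (\int[P]_x \int[unif01]_t
    iter_int unif01 m (fun ts => iter_int P m (fun xs => f ((x, t) :: zip xs ts)))).
  apply: eq_integral => x _; rewrite -integral_unif01.
  - apply: eq_integral => t _; apply: IH => //; exact: mfun_cons mf.
  - exact: (measurableT_comp mg (pair1_measurable x)).
  - by move=> t; apply: iter_int_ge0 => ?; exact: iter_int_ge0.
rewrite (fubini_tonelli (m1 := P) (m2 := unif01) (fun p : T * T =>
    iter_int unif01 m (fun ts => iter_int P m (fun xs => f (p :: zip xs ts)))))//=; last first.
  by move=> p; apply: iter_int_ge0 => ?; exact: iter_int_ge0.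
apply: eq_integral => t _.
rewrite (@iter_int_swap _ _ _ unif01 _ _ P m
  (fun x ts => iter_int P m (fun xs => f ((x, t) :: zip xs ts))))//.
  by move=> *; exact: iter_int_ge0.
move=> dX X y L my mL.
apply: (@jmeas_iter_int _ _ _ P _ X _ (fun z xs => f ((y z, t) :: zip xs (L z)))).
  by move=> *; exact: f0.
move=> dZ Z w M mw mM; apply: mf; apply: mlist_cons.
  by apply: measurable_fun_pair => //; exact: (measurableT_comp my mw).
by apply: mlist_zip => //; exact: (mlist_comp mw mL).
Qed.

Lemma mlist_unzip1 dX (X : measurableType dX) m (L : X -> seq (T * T)%type) :
  mlist m L -> mlist m (fun x => unzip1 (L x)).
Proof.
move=> [sL mL]; split=> [x|t0 i]; first by rewrite size_map.
rewrite (_ : (fun _ => _) = fun x => (nth (t0, 0%R : T) (L x) i).1).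
  exact: (measurableT_comp measurable_fst).
apply/funext => x; have [ix|ix] := ltnP i (size (L x)).
  by rewrite (nth_map (t0, 0%R : T)).
by rewrite !nth_default// size_map.
Qed.

Lemma mlist_unzip2 dX (X : measurableType dX) m (L : X -> seq (T * T)%type) :
  mlist m L -> mlist m (fun x => unzip2 (L x)).
Proof.
move=> [sL mL]; split=> [x|t0 i]; first by rewrite size_map.
rewrite (_ : (fun _ => _) = fun x => (nth (0%R : T, t0) (L x) i).2).
  exact: (measurableT_comp measurable_snd).
apply/funext => x; have [ix|ix] := ltnP i (size (L x)).
  by rewrite (nth_map (0%R : T, t0)).
by rewrite !nth_default// size_map.
Qed.

(* The arrival order depends on the times only, and for fixed times the values
   are exchangeable. *)
Lemma E_inst_arrival (P : prob R) m (Phi : seq R -> seq R -> \bar R) :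
  (forall xs ts, 0 <= Phi xs ts) -> mfun2 m m Phi ->
  E_inst P m (fun s => Phi [seq nth 0%R (unzip1 s) j | j <- arrival_perm (unzip2 s)]
                           (sort <=%R (unzip2 s))) =
  iter_int unif01 m (fun ts => iter_int P m (fun xs => Phi xs (sort <=%R ts))).
Proof.
move=> P0 mP; rewrite E_instE//; last first.
  move=> dX X L mL; apply: mP; first apply: mlist_arrival_perm.
  - exact: (mlist_unzip1 mL).
  - exact: (mlist_unzip2 mL).
  - exact: (mlist_sort (mlist_unzip2 mL)).
apply: eq_iter_int => ts st.
transitivity (iter_int P m (fun xs =>
    Phi [seq nth 0%R xs j | j <- arrival_perm ts] (sort <=%R ts))).
  by apply: eq_iter_int => xs sx; rewrite unzip1_zip ?unzip2_zip ?sx ?st.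
apply: (@iter_int_perm _ _ _ P m (fun xs => Phi xs (sort <=%R ts)) 0%R (arrival_perm ts)) => //.
  by rewrite -st; exact: arrival_perm_perm.
move=> dX X L mL; apply: mP => //.
by rewrite -st -(size_sort <=%R); exact: mlist_cst.
Qed.

End Unfold.

(** * Joint law of a block maximum and its position *)

Section Block.
Context {R : realType}.
Local Notation T := (measurableTypeR R).
Local Open Scope ereal_scope.

Lemma cdfE (P : prob R) x : (cdf P x)%:E = P [set` `]-oo, x]].
Proof. by rewrite /cdf fineK// fin_num_measure. Qed.

Lemma cdf_ge0 (P : prob R) x : (0 <= cdf P x)%R.
Proof. by rewrite /cdf fine_ge0. Qed.

Lemma cdf_nd (P : prob R) x y : (x <= y)%R -> (cdf P x <= cdf P y)%R.
Proof.
move=> xy; rewrite -lee_fin !cdfE le_measure ?inE//.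
by apply: subset_itvl; rewrite bnd_simp.
Qed.

Lemma measurable_cdf (P : prob R) : measurable_fun setT (cdf P).
Proof. by apply: nondecreasing_measurable => // x y; exact: cdf_nd. Qed.

(** A continuous cdf has no atoms: the nontrivial inequality is obtained from the points x -
    1/(n+1), which approach x from below. *)
Lemma cdf_open (P : prob R) x : continuous (cdf P) ->
  P [set` `]-oo, x[] = (cdf P x)%:E.
Proof.
move=> cF; apply/eqP; rewrite eq_le; apply/andP; split.
  by rewrite cdfE le_measure ?inE//; apply: subset_itvl; rewrite bnd_simp.
have h : (cdf P (x - n.+1%:R^-1))%:E @[n --> \oo] --> (cdf P x)%:E.
  apply: cvg_EFin; first by near=> n.
  have -> : fine \o (fun n => (cdf P (x - n.+1%:R^-1))%:E) =
    (cdf P \o (fun n => x - n.+1%:R^-1)%R) by [].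
  apply: continuous_cvg; first exact: cF.
  rewrite -[X in _ --> X]subr0; apply: cvgB; first exact: cvg_cst.
  exact: cvg_harmonic.
rewrite -(cvg_lim _ h)//; apply: lime_le; first by apply/cvg_ex; eexists; exact: h.
near=> n; rewrite cdfE le_measure ?inE//.
move=> y /=; rewrite !in_itv/= => /le_lt_trans; apply.
by rewrite ltrBlDr ltrDl invr_gt0.
Unshelve. all: by end_near. Qed.

Lemma mfun_all (A : {pred R}) n : measurable [set y : T | A y] ->
  mfun (T := T) n (fun s => (all A s)%:R%:E : \bar R).
Proof.
move=> mA dX X L mL; apply/measurable_EFinP.
rewrite (_ : (fun _ => _) = fun x => if all A (L x) then 1%R else 0%R).
  apply: measurable_fun_ifT => //.
  apply: (measurable_all (p := fun _ => A) mL) => h mh.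
  apply: (measurableT_comp _ mh).
  by apply: (measurable_fun_bool true); rewrite setTI.
by apply/funext => x; case: all.
Qed.

Lemma iter_int_all (P : prob R) (A : {pred R}) m :
  measurable [set x : T | A x] ->
  iter_int P m (fun s : seq T => (all A s)%:R%:E) = P [set x | A x] ^+ m.
Proof.
move=> mA; have mfA n := mfun_all (n := n) mA.
elim: m => [|m IH] //.
rewrite expeS /=; transitivity (\int[P]_x ((\1_[set x : T | A x] x)%:E * P [set x | A x] ^+ m)).
  apply: eq_integral => x _; rewrite -IH -iter_int_Zl//.
    apply: eq_iter_int => s _; rewrite indicE; case: (boolP (A x)) => Ax.
      by rewrite mem_set//= mul1e.
    by rewrite memNset ?mul0e//=; exact/negP.
rewrite ge0_integralZr//.
- by rewrite integral_indic// setIT.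
- exact/measurable_EFinP/measurable_indic.
- by rewrite expe_ge0.
Qed.

(* The k terms share the weight cdf^(k-1): by continuity of the cdf, it does not
   matter which of the k-1 comparisons defining [lastmax] are strict. *)
Lemma iter_int_block (P : prob R) k (phi : R -> nat -> \bar R) :
  continuous (cdf P) -> (0 < k)%N ->
  (forall x c, 0 <= phi x c) -> (forall c, measurable_fun setT (phi ^~ c)) ->
  iter_int P k (fun b : seq T => phi (bmax b) (lastmax b)) =
  \sum_(c < k) \int[P]_x (phi x c * (cdf P x ^+ k.-1)%:E).
Proof.
case: k => // k cP _ phi0 mphi.
pose ind c (b : seq R) := (lastmax b == c)%:R%:E : \bar R.
have mphic c : mfun (T := T) k.+1 (fun b => phi (nth 0%R b c) c * ind c b).
  move=> dX X L mL; apply: emeasurable_funM.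
    by have [_ mn] := mL; exact: (measurableT_comp (mphi c) (mn 0%R c)).
  apply/measurable_EFinP.
  rewrite (_ : (fun _ => _) = fun x => if lastmax (L x) == c then 1%R else 0%R).
    by apply: measurable_fun_ifT => //; exact: (dmeas_lastmax _ mL).
  by apply/funext => x; case: eqP.
have phi0c c b : 0 <= phi (nth 0%R b c) c * ind c b.
  by rewrite mule_ge0// lee_fin.
transitivity (iter_int P k.+1
    (fun b : seq T => \sum_(c < k.+1) phi (nth 0%R b c) c * ind c b)).
  apply: eq_iter_int => b sb.
  have lb : (lastmax b < k.+1)%N by rewrite -sb lastmax_lt//; case: b sb.
  rewrite (bigD1 (Ordinal lb))//= big1 ?adde0 /ind ?eqxx ?mule1// => c.
  by rewrite -val_eqE /= eq_sym => /negbTE ->; rewrite mule0.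
rewrite iter_int_sum//; apply: eq_bigr => c _.
have ck : (c <= k)%N by rewrite -ltnS.
rewrite (@iter_int_insert _ _ _ P c)//; apply: eq_integral => x _.
pose le := (fun y => y <= x)%R : {pred R}.
pose lt := (fun y => y < x)%R : {pred R}.
have mle : measurable [set y : T | le y].
  by rewrite (_ : [set y | _] = [set` `]-oo, x]])//; apply/seteqP; split => y /=;
    rewrite in_itv.
have mlt : measurable [set y : T | lt y].
  by rewrite (_ : [set y | _] = [set` `]-oo, x[])//; apply/seteqP; split => y /=;
    rewrite in_itv.
(* With the draw [x] at position [c] outermost, [x] is the last maximum iff the [c] draws before it
   are at most [x] and the [k - c] after it are below [x]. *)
transitivity (iter_int P (c + (k - c)) (fun s : seq T => phi x c *
   ((all le (take c s))%:R%:E * (all lt (drop c s))%:R%:E))).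
  rewrite subnKC//; apply: eq_iter_int => s sk.
  have sc : size (take c s) = c by rewrite size_takel// sk.
  rewrite /ind lastmaxP; last by rewrite -size_eq0 size_cat addnS.
  rewrite nth_cat sc ltnn subnn /= take_size_cat//.
  rewrite -cat_rcons drop_size_cat ?size_rcons ?sc//.
  rewrite size_cat size_rcons size_drop sc sk.
  have -> : (c < c.+1 + (k - c))%N by lia.
  by rewrite /= -EFinM -natrM mulnb.
rewrite iter_int_cat.
transitivity (iter_int P c (fun s : seq T => phi x c *
   ((P [set y | lt y] ^+ (k - c)) * (all le s)%:R%:E))).
  apply: eq_iter_int => s sc.
  transitivity (iter_int P (k - c) (fun s' : seq T =>
      (phi x c * (all le s)%:R%:E) * (all lt s')%:R%:E)).
    by apply: eq_iter_int => s' _; rewrite take_size_cat// drop_size_cat// muleA.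
  rewrite iter_int_Zl ?iter_int_all//; last 2 first.
  - by rewrite mule_ge0// lee_fin.
  - exact: mfun_all.
  by rewrite -muleA; congr (_ * _); rewrite muleC.
rewrite iter_int_Zl//; last 2 first.
- by move=> s; rewrite mule_ge0 ?expe_ge0// lee_fin.
- move=> dX X L mL; apply: emeasurable_funM => //; exact: (mfun_all _ mL).
rewrite iter_int_Zl ?expe_ge0//; last exact: mfun_all.
rewrite iter_int_all//; congr (_ * _).
have -> : P [set y | lt y] = (cdf P x)%:E.
  by rewrite -cdf_open//; congr (P _); apply/seteqP; split => y /=; rewrite in_itv.
have -> : P [set y | le y] = (cdf P x)%:E.
  by rewrite cdfE//; congr (P _); apply/seteqP; split => y /=; rewrite in_itv.
by rewrite -!EFin_expe -EFinM -exprD subnK.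
Qed.
End Block.

(** * The block maximum has law F, with an independent uniform position *)

Section Uniqueness.
Context {R : realType}.
Local Notation T := (measurableTypeR R).
Local Open Scope ereal_scope.

Lemma cdf_inj (P Q : prob R) : cdf P =1 cdf Q ->
  forall A : set T, measurable A -> P A = Q A.
Proof.
move=> PQ A mA.
refine (@measure_unique _ R T R.-ocitv.-measurable
  (fun n => `](- n%:R)%R, n%:R]%classic) _ _ _ _ P Q _ _ A mA) => //.
- exact: ocitvI.
- by move=> n; exact: is_ocitv.
- exact: (bigcup_itvT false false).
- move=> _ [[a b] _ <-] /=.
  have [ab|ba] := leP a b; last first.
    by rewrite set_itv_ge ?measure0// bnd_simp -leNgt ltW.
  have E : `]a, b]%classic = `]-oo, b] `\` `]-oo, a] :> set R.
    by rewrite -[RHS]setCK setCD setCitvl setUC -[LHS]setCK setCitv.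
  have H (M : prob R) : M `]a, b]%classic = (cdf M b - cdf M a)%:E.
    rewrite E measureD ?setIidr//; first by rewrite EFinB !cdfE.
      exact: subset_itvl.
    by rewrite -ge0_fin_numE// fin_num_measure.
  by rewrite !H !PQ.
- by move=> n; rewrite -ge0_fin_numE// fin_num_measure.
Qed.

Section max_law.
Variables P Q : prob R.

Let maxT (z : T * T) : T := Num.max (z.1 : R) z.2.

Let measurable_maxT : measurable_fun setT maxT.
Proof. by apply: measurable_maxr; [exact: measurable_fst|exact: measurable_snd]. Qed.

HB.instance Definition _ := isMeasurableFun.Build _ _ _ _ maxT measurable_maxT.

(** A pushforward of the product measure, packed as a probability so that [iter_int_bmax_law] can
    iterate the construction. *)
Definition max_law (A : set T) : \bar R := (P \x Q) (maxT @^-1` A).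

Let max_law0 : max_law set0 = 0.
Proof. by rewrite /max_law preimage_set0 measure0. Qed.

Let max_law_ge0 A : 0 <= max_law A.
Proof. exact: measure_ge0. Qed.

Let max_law_sigma_additive : semi_sigma_additive max_law.
Proof.
exact: (@measure_semi_sigma_additive _ _ _ (pushforward (P \x Q) maxT)).
Qed.

HB.instance Definition _ := isMeasure.Build _ _ _ max_law
  max_law0 max_law_ge0 max_law_sigma_additive.

Let max_law_setT : max_law setT = 1.
Proof.
rewrite /max_law preimage_setT -setXTT product_measure1E//.
by rewrite -[RHS]mule1; congr (_ * _); exact: probability_setT.
Qed.

HB.instance Definition _ := Measure_isProbability.Build _ _ _ max_law max_law_setT.

Lemma cdf_max_law x : cdf max_law x = (cdf P x * cdf Q x)%R.
Proof.
rewrite {1}/cdf /= /max_law.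
have -> : maxT @^-1` [set` `]-oo, x]] = [set` `]-oo, x]] `*` [set` `]-oo, x]].
  apply/seteqP; split=> -[a b]; rewrite /maxT /= !in_itv/= ge_max.
    by move=> /andP[].
  by move=> [-> ->].
by rewrite product_measure1E// fineM// fin_num_measure.
Qed.

Lemma integral_max_law (psi : R -> \bar R) : (forall x, 0 <= psi x) ->
  measurable_fun setT psi ->
  \int[max_law]_x psi x = \int[P]_x \int[Q]_y psi (Num.max x y).
Proof.
move=> psi0 mpsi.
rewrite -(fubini_tonelli1 (m1 := P) (m2 := Q) (psi \o maxT)); last 2 first.
- exact: (measurableT_comp mpsi measurable_maxT).
- by move=> z; exact: psi0.
by rewrite -[RHS](@ge0_integral_pushforward _ _ _ _ _ _ measurable_maxT (P \x Q)%E setT psi).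
Qed.

End max_law.

(** [Q] is built by adding one draw at a time through [max_law]. Its cdf then identifies it with
    [F], by [cdf_inj]. *)
Lemma iter_int_bmax_law (P : prob R) k : (0 < k)%N ->
  exists Q : prob R, (forall x, cdf Q x = (cdf P x ^+ k)%R) /\
    forall psi : R -> \bar R, (forall x, 0 <= psi x) -> measurable_fun setT psi ->
      iter_int P k (fun b : seq T => psi (bmax b)) = \int[Q]_x psi x.
Proof.
case: k => // k _; elim: k => [|k [Q [cQ EQ]]].
  by exists P; split=> // psi psi0 mpsi.
exists (max_law P Q); split=> [x|psi psi0 mpsi].
  by rewrite cdf_max_law cQ -exprS.
rewrite integral_max_law//.
apply: eq_integral => x _.
rewrite -[LHS]/(iter_int P k.+1 (fun s => psi (bmax (x :: s)))).
rewrite -(EQ (fun y => psi (Num.max x y)))//.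
  apply: eq_iter_int => b sb; rewrite bmax_cons//.
  by rewrite -size_eq0 sb.
by apply: (measurableT_comp mpsi); exact: measurable_maxr.
Qed.

Lemma iter_int_bmax (P F : prob R) k (psi : R -> \bar R) : (0 < k)%N ->
  (forall x, cdf F x = (cdf P x ^+ k)%R) ->
  (forall x, 0 <= psi x) -> measurable_fun setT psi ->
  iter_int P k (fun b : seq T => psi (bmax b)) = \int[F]_x psi x.
Proof.
move=> k0 FP psi0 mpsi; have [Q [cQ ->//]] := iter_int_bmax_law P k0.
apply: eq_measure_integral => A mA _; apply: cdf_inj => // x.
by rewrite cQ FP.
Qed.

(** In [iter_int_block] the weight is the same for all positions. Applied a second time, to the
    function [phi x c] with [c] frozen, it gives k equal terms whose sum is the integral against
    [F]; hence the factor 1/k, without computing a density of [F] with respect to [P]. *)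
Lemma iter_int_block_unif (P F : prob R) k (phi : R -> nat -> \bar R) :
  (0 < k)%N -> continuous (cdf P) -> (forall x, cdf F x = (cdf P x ^+ k)%R) ->
  (forall x c, 0 <= phi x c) -> (forall c, measurable_fun setT (phi ^~ c)) ->
  iter_int P k (fun b : seq T => phi (bmax b) (lastmax b)) =
  \sum_(c < k) (k%:R^-1)%:E * \int[F]_x phi x c.
Proof.
move=> k0 cP FP phi0 mphi; rewrite iter_int_block//; apply: eq_bigr => c _.
rewrite -(iter_int_bmax k0 FP)// (@iter_int_block _ P k (fun x _ => phi x c))//.
set I := \int[P]_x _.
rewrite (eq_bigr (fun=> 1%:E * I)) => [|? _]; last by rewrite mul1e.
rewrite -ge0_sume_distrl// sumEFin sumr_const card_ord.
rewrite muleA -EFinM mulVf ?mul1e//.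
by rewrite pnatr_eq0 -lt0n.
Qed.
End Uniqueness.

(** * The k-th root of the cdf of a prior is the cdf of a prior *)

Section Root.
Context {R : realType}.
Local Notation T := (measurableTypeR R).
Implicit Types a b : R.

Lemma exprD_ge k a b : (0 < k)%N -> 0 <= a -> 0 <= b ->
  a ^+ k + b ^+ k <= (a + b) ^+ k.
Proof.
case: k => // k _ a0 b0; elim: k => [|k IH]; first by rewrite !expr1.
rewrite (exprS (a + b)); apply: le_trans (ler_wpM2l _ IH); last exact: addr_ge0.
rewrite mulrDl !mulrDr -!exprS -addrA lerD2l addrA lerDr.
by rewrite addr_ge0// mulr_ge0// exprn_ge0.
Qed.

Lemma root_powRK k a : (0 < k)%N -> 0 <= a -> (a `^ k%:R^-1) ^+ k = a.
Proof.
move=> k0 a0; rewrite -powR_mulrn ?powR_ge0// -powRrM mulVf ?powRr1//.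
by rewrite pnatr_eq0 -lt0n.
Qed.

(** Superadditivity of the k-th power, applied to the smaller root and the difference of the roots.
    The resulting modulus of continuity is uniform, also near 0. *)
Lemma norm_root_le k a b : (0 < k)%N -> 0 <= a -> 0 <= b ->
  `|a `^ k%:R^-1 - b `^ k%:R^-1| ^+ k <= `|a - b|.
Proof.
move=> k0; wlog ba : a b / b <= a.
  move=> H a0 b0; have [ba|/ltW ab] := leP b a; first exact: H.
  by rewrite distrC (distrC a); exact: H.
move=> a0 b0; have r_le : b `^ k%:R^-1 <= a `^ k%:R^-1.
  by apply: ge0_ler_powR => //; rewrite invr_ge0.
rewrite !ger0_norm ?subr_ge0// lerBrDr -{2}(root_powRK k0 b0).
rewrite -[leRHS](root_powRK k0 a0).
rewrite -{2}(subrK (b `^ k%:R^-1) (a `^ k%:R^-1)) exprD_ge ?powR_ge0//.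
by rewrite subr_ge0.
Qed.

(** A general filter covers both continuity at a point and the limit at infinity. *)
Lemma cvg_root (S : Type) (D : set_system S) (f : S -> R) (l : R) k : Filter D ->
  (0 < k)%N -> (forall x, 0 <= f x) -> 0 <= l -> f @ D --> l ->
  (f x `^ k%:R^-1) @[x --> D] --> l `^ k%:R^-1.
Proof.
move=> FD k0 f0 l0 /cvgrPdist_lt fl; apply/cvgrPdist_lt => e e0.
have ek : 0 < e ^+ k by rewrite exprn_gt0.
apply: filterS (fl _ ek) => x fx.
rewrite ltNge; apply/negP => ex.
have := le_lt_trans (norm_root_le k0 l0 (f0 x)) fx.
by rewrite ltNge lerXn2r// nnegrE// ltW.
Qed.

Section cdf_limits.
Variable P : prob R.

(** The identity as a random variable under [P], through which the limit theorem for
    [random_variable.cdf] applies to [cdf P]. *)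
Let idTR : T -> R := idfun.

#[local] HB.instance Definition _ :=
  @isMeasurableFun.Build _ _ _ _ idTR (@measurable_id _ _ setT).

Lemma cvg_cdf_y : cdf P @ +oo --> (1 : R).
Proof.
have h : fine \o random_variable.cdf (idTR : {RV P >-> R}) @ +oo --> (1 : R).
  exact/fine_cvg/cvg_cdfy1.
exact: h.
Qed.

End cdf_limits.

Section root_prior.
Variables (F : prob R) (k : nat).
Hypotheses (k0 : (0 < k)%N) (priorF : is_prior F).

Let g x : R := cdf F x `^ k%:R^-1.

Let g_nd : nondecreasing g.
Proof.
by move=> x y xy; apply: ge0_ler_powR;
  rewrite ?invr_ge0 ?nnegrE ?cdf_ge0// cdf_nd.
Qed.

Let g_continuous : continuous g.
Proof.
by move=> x; apply: cvg_root => //; [exact: cdf_ge0|exact: cdf_ge0|exact: priorF.1].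
Qed.

Let g_rc : right_continuous g.
Proof. by move=> x; apply: cvg_at_right_filter; exact: g_continuous. Qed.

Let g_lt0 x : x < 0 -> g x = 0.
Proof.
(* [powR] sends 0 to 0 only for a nonzero exponent, which [k0] provides. *)
move=> x0; rewrite /g priorF.2.1// powR0// invr_eq0 pnatr_eq0 -lt0n//.
Qed.

Let g_Ny : g @ -oo --> (0 : R).
Proof.
apply: cvg_near_cst; near=> x; apply: g_lt0; near: x.
exact: nbhs_ninfty_lt.
Unshelve. all: by end_near. Qed.

Let g_y : g @ +oo --> (1 : R).
Proof.
have := @cvg_root _ _ (cdf F) 1 k _ k0 (cdf_ge0 F) ler01 (cvg_cdf_y F).
by rewrite powR1; exact.
Qed.

#[local] HB.instance Definition _ := isCumulative.Build R _ R g g_nd g_rc.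
#[local] HB.instance Definition _ := isCumulativeBounded.Build R 0 1 g g_Ny g_y.

(** The measure is the Lebesgue-Stieltjes measure of [g]; full support survives because the root is
    strictly increasing. *)
Lemma root_prior :
  exists P : prob R, is_prior P /\ forall x, cdf P x = cdf F x `^ k%:R^-1.
Proof.
pose P : prob R := lebesgue_stieltjes_measure g.
have PE x : cdf P x = g x.
  have := cdf_lebesgue_stieltjes_id (g : cumulativeBounded 0 1) x.
  by rewrite /cdf /random_variable.cdf /distribution /pushforward /= preimage_id => ->.
exists P; split=> //.
rewrite /is_prior (_ : cdf P = g); last exact/funext.
split; first exact: g_continuous.
split; first exact: g_lt0.
move=> x y x0 xy; apply: gt0_ltr_powR; rewrite ?nnegrE ?cdf_ge0//.
  by rewrite invr_gt0 ltr0n.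
exact: priorF.2.2.
Qed.

End root_prior.
End Root.

(** * Averages over uniform choices *)

Section Choices.
Context {R : realType}.
Local Open Scope ereal_scope.

(** Nested so as to follow an induction over blocks; [choice_avg_ffun] relates it to the average
    over finite functions in [reward_B]. *)
Fixpoint choice_avg (k n : nat) (f : seq nat -> \bar R) : \bar R :=
  match n with
  | 0 => f [::]
  | n'.+1 => \sum_(c < k) (k%:R^-1)%:E * choice_avg k n' (fun s => f (nat_of_ord c :: s))
  end.

Let invk_ge0 k : 0 <= (k%:R^-1 : R)%:E.
Proof. by rewrite lee_fin invr_ge0. Qed.

Lemma choice_avg_ge0 k n f : (forall s, 0 <= f s) -> 0 <= choice_avg k n f.
Proof.
elim: n f => [|n IH] f f0 //=; apply: sume_ge0 => c _.
by rewrite mule_ge0// IH.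
Qed.

Lemma choice_avg_cst k n (a : \bar R) : (0 < k)%N -> 0 <= a -> choice_avg k n (fun=> a) = a.
Proof.
move=> k0 a0; elim: n => //= n ->.
rewrite -ge0_sume_distrl// sumEFin sumr_const card_ord -[(_ *+ k)%R]mulr_natl.
by rewrite mulfV ?mul1e// pnatr_eq0 -lt0n.
Qed.

Lemma measurable_choice_avg dX (X : measurableType dX) k n (h : X -> seq nat -> \bar R) :
  (forall cs, measurable_fun setT (h ^~ cs)) ->
  measurable_fun setT (fun x => choice_avg k n (h x)).
Proof.
elim: n h => [|n IH] h mh /=; first exact: mh.
apply: emeasurable_sum => c; apply: measurable_funeM.
by apply: (IH (fun x s => h x (nat_of_ord c :: s))) => cs; exact: mh.
Qed.

Lemma integral_choice_avg d (T : measurableType d) (P : probability T R) k n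
    (h : T -> seq nat -> \bar R) :
  (forall x cs, 0 <= h x cs) -> (forall cs, measurable_fun setT (h ^~ cs)) ->
  \int[P]_x choice_avg k n (h x) = choice_avg k n (fun cs => \int[P]_x h x cs).
Proof.
elim: n h => [|n IH] h h0 mh //=.
have mE (c : 'I_k) : measurable_fun setT
    (fun x => choice_avg k n (fun s => h x (nat_of_ord c :: s))).
  by apply: (@measurable_choice_avg _ _ _ _ (fun x s => h x (nat_of_ord c :: s))) => cs; exact: mh.
rewrite ge0_integral_sum//; last 2 first.
- by move=> c; exact: measurable_funeM.
- by move=> c x _; rewrite mule_ge0// choice_avg_ge0.
apply: eq_bigr => c _; rewrite ge0_integralZl//; last first.
  by move=> x _; exact: choice_avg_ge0.
by rewrite (IH (fun x s => h x (nat_of_ord c :: s))).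
Qed.

Lemma iter_int_choice_avg d (T : measurableType d) (P : probability T R) m k n
    (h : seq T -> seq nat -> \bar R) :
  (forall s cs, 0 <= h s cs) -> (forall cs, mfun m (h ^~ cs)) ->
  iter_int P m (fun s => choice_avg k n (h s)) = choice_avg k n (fun cs => iter_int P m (h ^~ cs)).
Proof.
elim: m h => [|m IH] h h0 mh //=.
rewrite -(@integral_choice_avg _ _ P k n (fun x cs => iter_int P m (fun s => h (x :: s) cs))).
- apply: eq_integral => x _; apply: (IH (fun s => h (x :: s))) => // cs.
  exact: (mfun_cons x (mh cs)).
- by move=> x cs; exact: iter_int_ge0.
- by move=> cs; apply: (@mfun_iter_int _ _ _ P _ (h ^~ cs)).
Qed.

Lemma choice_avg_tuple k n f : (forall s, 0 <= f s) ->
  choice_avg k n f = \sum_(t : n.-tuple 'I_k) ((k ^ n)%:R^-1)%:E * f (map (@nat_of_ord k) t).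
Proof.
elim: n f => [|n IH] f f0.
  rewrite expn0 invr1 (big_pred1 [tuple]) ?mul1e// => t.
  by apply/esym/eqP; exact: tuple0.
rewrite /= (reindex (fun p : 'I_k * n.-tuple 'I_k => cons_tuple p.1 p.2)) /=.
  rewrite -(pair_bigA _ (fun (c : 'I_k) (t : n.-tuple 'I_k) =>
    ((k ^ n.+1)%:R^-1)%:E * f (nat_of_ord c :: map (@nat_of_ord k) t))) /=.
  apply: eq_bigr => c _; rewrite IH// ge0_sume_distrr//; last first.
    by move=> t _; rewrite mule_ge0.
  by apply: eq_bigr => t _; rewrite muleA -EFinM -invfM -natrM -expnS.
exists (fun t => (thead t, behead_tuple t)) => [[c t] _|t _] /=.
  by congr pair; apply/val_inj.
by rewrite [RHS]tuple_eta.
Qed.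

Lemma choice_avg_ffun k n f : (forall s, 0 <= f s) ->
  choice_avg k n f = \sum_(c : {ffun 'I_n -> 'I_k})
    (#|{ffun 'I_n -> 'I_k}|%:R^-1)%:E * f [seq nat_of_ord (c r) | r <- enum 'I_n].
Proof.
move=> f0; rewrite choice_avg_tuple//.
rewrite (reindex (fun c : {ffun 'I_n -> 'I_k} => mktuple c)) /=.
  apply: eq_bigr => c _; rewrite card_ffun !card_ord; congr (_ * f _).
  by rewrite -map_comp.
exists (fun t => [ffun i => tnth t i]) => [c _|t _].
  by apply/ffunP => i; rewrite ffunE tnth_mktuple.
by apply: eq_from_tnth => i; rewrite tnth_mktuple ffunE.
Qed.

End Choices.

(** * The law of all block maxima and their positions *)

Section Blocks.
Context {R : realType}.
Local Notation T := (measurableTypeR R).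
Local Open Scope ereal_scope.

Lemma iter_int_blocks (P F : prob R) k n (Psi : seq R -> seq nat -> \bar R) :
  (0 < k)%N -> continuous (cdf P) -> (forall x, cdf F x = (cdf P x ^+ k)%R) ->
  (forall ys cs, 0 <= Psi ys cs) -> (forall cs, mfun (T := T) n (Psi ^~ cs)) ->
  iter_int P (n * k) (fun xs : seq T => Psi (map bmax (reshape (nseq n k) xs))
                                 (map lastmax (reshape (nseq n k) xs))) =
  choice_avg k n (fun cs => iter_int F n (fun ys : seq T => Psi ys cs)).
Proof.
move=> k0 cP FP; elim: n Psi => [|n IH] Psi Psi0 mPsi //.
rewrite mulSn iter_int_cat.
(* The contribution of the other [n] blocks, given the maximum [x] of the first block and its
   position [c]. *)
pose phi (x : R) (c : nat) :=
  choice_avg k n (fun cs => iter_int F n (fun ys : seq T => Psi (x :: ys) (c :: cs))).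
have mE c cs : measurable_fun setT
    (fun x : T => iter_int F n (fun ys : seq T => Psi (x :: ys) (c :: cs))).
  by apply: (@mfun_iter_int _ _ T F _ (Psi ^~ (c :: cs))).
transitivity (iter_int P k (fun b : seq T => phi (bmax b) (lastmax b))).
  apply: eq_iter_int => b sb.
  rewrite /phi -(IH (fun ys cs => Psi (bmax b :: ys) (lastmax b :: cs)))//.
    by apply: eq_iter_int => s _ /=; rewrite take_size_cat// drop_size_cat.
  by move=> cs; exact: (mfun_cons _ (mPsi (lastmax b :: cs))).
rewrite (iter_int_block_unif (F := F))//=.
- apply: eq_bigr => c _; congr (_ * _); rewrite /phi.
  rewrite (@integral_choice_avg _ _ T F k n
    (fun x cs => iter_int F n (fun ys => Psi (x :: ys) (nat_of_ord c :: cs))))//.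
  by move=> x cs; exact: iter_int_ge0.
- by move=> x c; apply: choice_avg_ge0 => cs; exact: iter_int_ge0.
- by move=> c; apply: measurable_choice_avg => cs; exact: mE.
Qed.

End Blocks.

(** * Expectations see only times in [0, 1] *)

Section Congruence.
Context {R : realType}.
Implicit Types P : prob R.

Lemma eq_E_inst P m (f g : inst R -> \bar R) :
  (forall s, size s = m -> all (fun p => 0 <= p.2 <= 1) s -> f s = g s) ->
  E_inst P m f = E_inst P m g.
Proof.
elim: m f g => [|m IH] f g fg /=; first exact: fg.
apply: eq_integral => x _; apply: eq_integral => t /[!inE]/= t01.
apply: IH => s sm s01; apply: fg; rewrite /= ?sm// s01 andbT.
by move: t01; rewrite in_itv.
Qed.

Lemma eq_E_unif m (f g : seq R -> \bar R) :
  (forall s, size s = m -> all (fun t => 0 <= t <= 1) s -> f s = g s) ->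
  E_unif m f = E_unif m g.
Proof.
elim: m f g => [|m IH] f g fg /=; first exact: fg.
apply: eq_integral => t /[!inE]/= t01.
apply: IH => s sm s01; apply: fg; rewrite /= ?sm// s01 andbT.
by move: t01; rewrite in_itv.
Qed.

End Congruence.

(** * Comparison of the expected rewards and of the benchmarks *)

Section Comparison.
Context {R : realType}.
Local Notation T := (measurableTypeR R).
Local Open Scope ereal_scope.
Variables (theta : R -> R) (F P Ft Pt : prob R) (n k : nat).
Hypothesis theta_ni : forall s t, (s <= t -> theta t <= theta s)%R.
Hypothesis k0 : (0 < k)%N.
Hypothesis cP : continuous (cdf P).
Hypothesis PF : forall x, cdf P x = (cdf F x `^ k%:R^-1)%R.
Hypothesis PFt : forall x, cdf Pt x = (cdf Ft x `^ k%:R^-1)%R.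

Let FP x : cdf F x = (cdf P x ^+ k)%R.
Proof. by rewrite PF root_powRK// cdf_ge0. Qed.

Let m_theta : measurable_fun setT theta.
Proof. by apply: nonincreasing_measurable => // s t; exact: theta_ni. Qed.

Let mfun2_run_reward o a b : mfun2 a b (run_reward theta (cdf Pt) o).
Proof. by apply: mfun2_run_reward => //; exact: measurable_cdf. Qed.

Let mfun_run_reward o a ths :
  mfun (T := T) a (fun xs => run_reward theta (cdf Pt) o xs ths).
Proof.
move=> dX X L mL; apply: (@mfun2_run_reward o a (size ths)) => //.
Qed.

Lemma reward_AE o m : reward_A o P m (cdf Pt) theta =
  iter_int unif01 m (fun ts => iter_int P m (fun xs : seq T =>
    run_reward theta (cdf Pt) o xs (sort <=%R ts))).
Proof.
rewrite -E_inst_arrival//; last by move=> *; exact: run_reward_ge0.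
by apply: eq_E_inst => s _ _; exact: reward_accA.
Qed.

(** The expected reward of the reduction algorithm with its internal randomness frozen. *)
Let value_B o cs u := iter_int F n (fun ys : seq T =>
  run_reward theta (cdf Pt) o ys (pick_times k n (sort <=%R u) cs)).

Let value_B_ge0 o cs u : 0 <= value_B o cs u.
Proof. by apply: iter_int_ge0 => s; exact: run_reward_ge0. Qed.

Let mfun_value_B o cs : mfun (T := T) (n * k) (value_B o cs).
Proof.
move=> dX X L mL.
apply: (@jmeas_iter_int _ _ T F _ X n (fun x ys =>
   run_reward theta (cdf Pt) o ys (pick_times k n (sort <=%R (L x)) cs))).
  by move=> *; exact: run_reward_ge0.
move=> dY Y y M my mM; apply: (@mfun2_run_reward o n n) => //.
by apply: mlist_pick_times; apply: mlist_sort; exact: (mlist_comp my mL).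
Qed.

(** The reduction algorithm uses the arrival times of its own instance only through their order.
    Once the values are listed in arrival order, those times are integrated over a constant. *)
Lemma reward_BE o : reward_B o F n k (cdf Ft) theta =
  choice_avg k n (fun cs => iter_int unif01 (n * k) (value_B o cs)).
Proof.
rewrite choice_avg_ffun; last by move=> cs; exact: iter_int_ge0.
apply: eq_bigr => c _; congr (_ * _).
set cs := [seq _ | _ <- _].
rewrite -E_unifE//; apply: eq_E_unif => u _ _.
transitivity (E_inst F n (fun s => run_reward theta (cdf Pt) o
    [seq nth 0%R (unzip1 s) j | j <- arrival_perm (unzip2 s)] (pick_times k n (sort <=%R u) cs))).
  apply: eq_E_inst => s sn _; rewrite reward_accB//.
  by congr (run_reward _ _ _ _ _); apply/funext => x; rewrite PFt.
rewrite (@E_inst_arrival _ F n (fun xs _ => run_reward theta (cdf Pt) o xs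
    (pick_times k n (sort <=%R u) cs))); last 2 first.
- by move=> *; exact: run_reward_ge0.
- by move=> dX X L M mL _; exact: (mfun_run_reward o _ mL).
exact: iter_int_cst.
Qed.

(** The arrival times of A and the internal times of B are both n * k i.i.d. uniform times and are
    taken to be the same. For fixed times, [E] writes the reward of B as an integral over the values
    of A, where the pointwise comparison applies. *)
Lemma reward_A_le_B o :
  reward_A o P (n * k) (cdf Pt) theta <= reward_B o F n k (cdf Ft) theta.
Proof.
rewrite reward_AE reward_BE -iter_int_choice_avg; last 2 first.
- by move=> *; exact: value_B_ge0.
- by move=> cs; exact: mfun_value_B.
have E u : iter_int P (n * k) (fun xs : seq T =>
    run_reward theta (cdf Pt) o (map bmax (reshape (nseq n k) xs))
      (pick_times k n (sort <=%R u) (map lastmax (reshape (nseq n k) xs)))) =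
    choice_avg k n (fun cs => value_B o cs u).
  apply: (@iter_int_blocks _ P F k n (fun ys cs =>
    run_reward theta (cdf Pt) o ys (pick_times k n (sort <=%R u) cs))) => //.
    by move=> *; exact: run_reward_ge0.
apply: iter_int_le.
- by move=> ts; apply: iter_int_ge0 => s; exact: run_reward_ge0.
- by move=> ts; apply: choice_avg_ge0 => cs; exact: value_B_ge0.
- move=> dX X L mL.
  apply: (@jmeas_iter_int _ _ T P _ X (n * k) (fun x ys =>
    run_reward theta (cdf Pt) o ys (sort <=%R (L x)))).
    by move=> *; exact: run_reward_ge0.
  move=> dY Y y M my mM; apply: (@mfun2_run_reward o (n * k) (n * k)) => //.
  by apply: mlist_sort; exact: (mlist_comp my mL).
- by move=> dX X L mL; apply: measurable_choice_avg => cs; exact: mfun_value_B.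
move=> ts sts; rewrite -E; apply: iter_int_le.
- by move=> s; exact: run_reward_ge0.
- by move=> s; exact: run_reward_ge0.
- exact: mfun_run_reward.
- move=> dX X L mL.
  apply: (dmeas_case (f := fun cs x => run_reward theta (cdf Pt) o
    (map bmax (reshape (nseq n k) (L x))) (pick_times k n (sort <=%R ts) cs))).
    exact: dmeas_lastmax_blocks mL.
  by move=> cs; apply: (@mfun_run_reward o n); exact: mlist_bmax_blocks mL.
move=> xs sxs; apply: run_reward_blocks => //.
- by move=> x y; exact: cdf_nd.
- by rewrite size_sort.
- exact/sort_sorted/le_total.
Qed.

Lemma E_x_opt (Q : prob R) m : E_inst Q m (fun s => (x_opt s)%:E) =
  iter_int Q m (fun xs : seq T => (max0 xs)%:E).
Proof.
(* A dummy integral over the times gives the right side the shape of [E_inst_arrival]. *)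
rewrite -[RHS](iter_int_cst unif01 m) -(@E_inst_arrival _ Q m (fun xs _ => (max0 xs)%:E)).
- by apply: eq_E_inst => s _ _; rewrite x_opt_arrival_perm arrivalE valE.
- by move=> xs _; rewrite lee_fin max0_ge0.
- by move=> dX X L M mL _; apply/measurable_EFinP; exact: measurable_max0 mL.
Qed.

Lemma bench_eq o : bench o P (n * k) = bench o F n.
Proof.
case: o => //=; rewrite !E_x_opt.
transitivity (iter_int P (n * k) (fun xs : seq T =>
    (max0 (map bmax (reshape (nseq n k) xs)))%:E)).
  by apply: eq_iter_int => xs sxs; rewrite max0_blocks.
rewrite (@iter_int_blocks _ P F k n (fun ys _ => (max0 ys)%:E))//.
- by rewrite choice_avg_cst// iter_int_ge0// => s; rewrite lee_fin max0_ge0.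
- by move=> ys _; rewrite lee_fin max0_ge0.
- by move=> _ dX X L mL; apply/measurable_EFinP; exact: measurable_max0 mL.
Qed.

End Comparison.

(** * Extending the threshold function monotonically to the whole line *)

Section Clamp.
Context {R : realType}.
Variable theta : R -> R.
Hypothesis thetaP : is_threshold theta.

(* theta is unconstrained, possibly non-measurable, outside [0, 1]. *)
Definition clamp (t : R) : R := theta (Num.max 0 (Num.min 1 t)).

Lemma clampE t : 0 <= t <= 1 -> clamp t = theta t.
Proof. by move=> /andP[t0 t1]; rewrite /clamp (min_r t1) (max_r t0). Qed.

Lemma clamp_ni s t : s <= t -> clamp t <= clamp s.
Proof.
move=> st; apply: thetaP.2; first by rewrite le_max lexx.
  rewrite ge_max !le_max lexx /=; apply/orP; right.
  by rewrite le_min ge_min lexx ge_min st orbT.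
by rewrite ge_max ler01 ge_min lexx.
Qed.

Lemma reward_A_clamp o P m G : reward_A o P m G theta = reward_A o P m G clamp.
Proof.
apply: eq_E_inst => s _ s01; congr (reward o s (x_alg s _)).
apply/funext => j; rewrite /accA clampE// /time.
have [js|js] := ltnP j (size s).
  by have /allP := s01; apply; rewrite mem_nth.
(* Out of range, the default time 0 still lies in [0, 1]. *)
by rewrite nth_default//= lexx ler01.
Qed.

Lemma reward_B_clamp o P n k G :
  reward_B o P n k G theta = reward_B o P n k G clamp.
Proof.
apply: eq_bigr => c _; congr (_ * _)%E; apply: eq_E_unif => u su u01.
apply: eq_E_inst => s _ _; congr (reward o s (x_alg s _)).
apply/funext => j; rewrite /accB clampE// /s_thr; set i := (_ + _)%N.
have [js|js] := ltnP i (size (sort <=%R u)).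
  by have /allP := u01; apply; rewrite -(mem_sort <=%R) mem_nth.
by rewrite nth_default//= lexx ler01.
Qed.

End Clamp.

(** Consistency is the case [Ft = F], [Pt = P]; robustness leaves the pairs independent. *)
Lemma competitive_transfer (R : realType) (n k : nat) (theta : R -> R) o gamma
    (F Ft P Pt : prob R) : (0 < k)%N -> is_threshold theta ->
  continuous (cdf P) ->
  (forall x, cdf P x = cdf F x `^ k%:R^-1) ->
  (forall x, cdf Pt x = cdf Ft x `^ k%:R^-1) ->
  competitive o P (n * k) gamma (reward_A o P (n * k) (cdf Pt) theta) ->
  competitive o F n gamma (reward_B o F n k (cdf Ft) theta).
Proof.
move=> k0 thetaP cP PF PFt; rewrite /competitive (bench_eq n k0 cP PF).
move=> /le_trans; apply; rewrite reward_A_clamp// reward_B_clamp//.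
by apply: reward_A_le_B => //; exact: clamp_ni.
Qed.

Theorem mainTheorem7 (R : realType) (n k : nat) (theta : R -> R)
  (o : objective) (alpha beta : R) :
  (0 < k)%N ->
  is_threshold theta ->
  consistent_A o (n * k) theta alpha ->
  robust_A o (n * k) theta beta ->
  consistent_B o n k theta alpha /\ robust_B o n k theta beta.
Proof.
move=> k0 thetaP consA robA; split.
  move=> F /(root_prior k0)[P [priorP PF]].
  exact: (competitive_transfer k0 thetaP priorP.1 PF PF (consA P priorP)).
move=> F Ft /(root_prior k0)[P [priorP PF]] /(root_prior k0)[Pt [priorPt PFt]].
exact: (competitive_transfer k0 thetaP priorP.1 PF PFt (robA P Pt priorP priorPt)).
Qed.
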